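(* Let $\Omega\subset\mathbb{C}$ be a domain, let $c\in\Omega$, and let $\varphi$ be a weight on $\Omega$ which is bounded in a neighborhood of $c$. Then $$K^\Omega_{|z-c|^2\varphi}(z,w)=\frac{K^\Omega_\varphi(z,w)}{(z-c)(\overline{w}-\overline{c})}-\frac{K^\Omega_\varphi(z,c)\,K^\Omega_\varphi(c,w)}{(z-c)(\overline{w}-\overline{c})\,K^\Omega_\varphi(c,c)}$$ for $z,w\in\Omega$.
   Context: A weight on a domain $\Omega\subset\mathbb{C}$ is a nonnegative (measurable) function $\varphi$ on $\Omega$. Put $\langle f,h\rangle_\varphi=\int_\Omega f(w)\overline{h(w)}\varphi(w)\,dV_w$, where $dV$ is Lebesgue area measure, and let $A^2_\varphi(\Omega)=\{f \text{ holomorphic on }\Omega : \langle f,f\rangle_\varphi<\infty\}$. The weighted Bergman kernel $K_\varphi^\Omega:\Omega\times\Omega\to\mathbb{C}$ is the unique reproducing kernel of $A^2_\varphi(\Omega)$: it is holomorphic in the first variable, conjugate holomorphic in the second, satisfies $K^\Omega_\varphi(z,w)=\overline{K^\Omega_\varphi(w,z)}$, $K^\Omega_\varphi(\cdot,z)\in A^2_\varphi(\Omega)$, and $f(z)=\langle f,K^\Omega_\varphi(\cdot,z)\rangle_\varphi$ for all $f\in A^2_\varphi(\Omega)$ and $z\in\Omega$. Weights for which kernels are written are understood to be such that these kernels exist. $K^\Omega_{|z-c|^2\varphi}$ is the kernel for the weight $z\mapsto|z-c|^2\varphi(z)$. The formula presupposes $K^\Omega_\varphi(c,c)\neq0$,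 and its right-hand side is understood after removal of the removable singularities at $z=c$ and $w=c$. *)

(* Defs.v *)
(* MathComp / MathComp-Analysis: the complex plane is [R[i]] for [R : realType]. *)
From HB Require Import structures.
From mathcomp Require Import all_boot all_order all_algebra.
From mathcomp Require Import complex.
From mathcomp Require Import all_classical all_reals all_analysis.

Set Implicit Arguments.
Unset Strict Implicit.
Unset Printing Implicit Defensive.

Import Order.TTheory GRing.Theory Num.Theory.
Import numFieldNormedType.Exports.

Local Open Scope classical_set_scope.
Local Open Scope ring_scope.
Local Open Scope complex_scope.

(* The norm topology of the plane is carried by the alias [R[i]^o]; the casts
   below select it.  Functions defined on a domain [Omega] are represented by
   total functions, of which only the values on [Omega] are ever used. *)

Definition domain (R : realType) (Omega : set R[i]) : Prop :=
  [/\ Omega !=set0, open (Omega : set R[i]^o) & connected (Omega : set R[i]^o)].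

Definition holomorphic_on (R : realType) (Omega : set R[i])
    (f : R[i] -> R[i]) : Prop :=
  forall z, Omega z -> derivable (f : R[i]^o -> R[i]^o) z 1.

Definition punctured_cvg (R : realType) (f : R[i] -> R[i]) (c l : R[i]) : Prop :=
  (f : R[i]^o -> R[i]^o) z @[z --> (c : R[i]^o)^'] --> (l : R[i]^o).

Definition plane (R : realType) (p : R * R) : R[i] := p.1 +i* p.2.

(* The product of the one-dimensional measures only lives on the Borel sets of
   the plane; its completion is the Lebesgue area measure, with the Lebesgue
   measurable sets as sigma-algebra. *)
Definition area_borel (R : realType) : {measure set (measurableTypeR R * measurableTypeR R) -> \bar R} :=
  ((@lebesgue_measure R) \x (@lebesgue_measure R))%E.

Definition planeT (R : realType) : measurableType _ :=
  caratheodory_type (@area_borel R)^*%mu.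

Definition area (R : realType) : {measure set (planeT R) -> \bar R} :=
  @completed_measure_extension _ _ R (@area_borel R).

Definition weight (R : realType) (Omega : set R[i]) (phi : R[i] -> R) : Prop :=
  (forall z, Omega z -> 0 <= phi z) /\
  measurable_fun ((@plane R @^-1` Omega) : set (planeT R)) (phi \o @plane R).

Definition bounded_around (R : realType) (Omega : set R[i]) (phi : R[i] -> R)
    (c : R[i]) : Prop :=
  exists M : R, \forall z \near (c : R[i]^o), Omega z -> phi z <= M.

Definition Cintegral (R : realType) (Omega : set R[i]) (F : R[i] -> R[i]) : R[i] :=
  (\int[@area R]_(p in @plane R @^-1` Omega) complex.Re (F (plane p)))%R +i*
  (\int[@area R]_(p in @plane R @^-1` Omega) complex.Im (F (plane p)))%R.

Definition wdot (R : realType) (Omega : set R[i]) (phi : R[i] -> R)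
    (f h : R[i] -> R[i]) : R[i] :=
  Cintegral Omega (fun w => f w * conjc (h w) * (phi w)%:C).

(* Finiteness of <f, f> is a statement about the extended-real integral of
   |f|^2 phi; [wdot] itself takes finite values by convention. *)
Definition A2 (R : realType) (Omega : set R[i]) (phi : R[i] -> R) :
    set (R[i] -> R[i]) :=
  [set f | holomorphic_on Omega f /\
     (\int[@area R]_(p in @plane R @^-1` Omega)
        (ComplexField.Normc.normc (f (plane p)) ^+ 2 * phi (plane p))%:E < +oo)%E].

Definition bergman_kernel (R : realType) (Omega : set R[i]) (phi : R[i] -> R)
    (K : R[i] -> R[i] -> R[i]) : Prop :=
  [/\ forall w, Omega w -> holomorphic_on Omega (K ^~ w),
      forall z, Omega z -> holomorphic_on Omega (fun w => conjc (K z w)),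
      forall z w, Omega z -> Omega w -> K z w = conjc (K w z),
      forall z, Omega z -> A2 Omega phi (K ^~ z) &
      forall f z, A2 Omega phi f -> Omega z -> f z = wdot Omega phi f (K ^~ z)].

(* [G] is [F], given on (Omega \ {c}) x (Omega \ {c}), after removal of the
   singularities at z = c and at w = c: these are removed one variable at a
   time, the value at (c, c) being the iterated limit, taken in either order. *)
Definition removes_singularities (R : realType) (Omega : set R[i]) (c : R[i])
    (F G : R[i] -> R[i] -> R[i]) : Prop :=
  [/\ forall z w, Omega z -> Omega w -> z != c -> w != c -> G z w = F z w,
      forall w, Omega w -> w != c -> punctured_cvg (F ^~ w) c (G c w),
      forall z, Omega z -> z != c -> punctured_cvg (F z) c (G z c),
      punctured_cvg (G ^~ c) c (G c c) &
      punctured_cvg (G c) c (G c c)].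

(* Main.v *)
(* Put k_z = K(., z) - (K(c, z) / K(c, c)) K(., c).  It lies in A^2_phi and
   vanishes at c, so k_z = (. - c) h with h holomorphic and h in
   A^2_{|. - c|^2 phi}.  For g = (. - c) Kc(., w), which also vanishes at c, the
   reproducing property of K gives <g, k_z>_phi = g(z) = (z - c) Kc(z, w), while
   the reproducing property of Kc gives h(w) = <h, Kc(., w)>_{|. - c|^2 phi}
   = <k_z, g>_phi.  Comparing the two yields the formula off z = c and w = c; the
   limits follow since Kc is continuous in each variable.

   The analytic input is that h is complex differentiable at c, although k_z is
   only assumed to have a complex derivative at each point.  Goursat's lemma on rectangles
   gives Cauchy's formula f(w) J(1/(t - w)) = J(f(t)/(t - w)), where J is the
   integral in t along a square around c, without evaluating J(1/(t - w)).
   Expanding 1/(t - w) around w = c shows that both integrals are quadratic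
   polynomials in w - c up to O(|w - c|^3), and J(1/(t - c)) <> 0, so f is a
   quadratic polynomial up to O(|w - c|^3) too, which makes the difference
   quotient of f at c differentiable at c. *)
Require Import Defs.
From HB Require Import structures.
From mathcomp Require Import all_boot all_order all_algebra.
From mathcomp Require Import complex.
From mathcomp Require Import all_classical all_reals all_analysis measurable_realfun.
From mathcomp Require Import ring lra.
Import Order.TTheory GRing.Theory Num.Theory.
Import numFieldNormedType.Exports.
Local Open Scope classical_set_scope.
Local Open Scope ring_scope.
Local Open Scope complex_scope.
Set Implicit Arguments.
Unset Strict Implicit.
Unset Printing Implicit Defensive.

Local Notation normc := (@ComplexField.Normc.normc _).

(** * The complex plane *)

Section ComplexPlane.
Variable R : realType.
Implicit Types (z w : R[i]) (f g : R[i] -> R[i]).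
Local Notation C := (R[i]^o).

Lemma norm_normc z : `|z| = (normc z)%:C.
Proof. by rewrite normc_def; case: z. Qed.

Lemma normc_ge0 z : 0 <= normc z.
Proof. by case: z => x y; exact: sqrtr_ge0. Qed.

Lemma normc_eq0 z : (normc z == 0) = (z == 0).
Proof.
apply/eqP/eqP => [/ComplexField.Normc.eq0_normc //|->].
exact: ComplexField.Normc.normc0.
Qed.

Lemma normc_gt0 z : (0 < normc z) = (z != 0).
Proof. by rewrite lt_def normc_eq0 normc_ge0 andbT. Qed.

Lemma normcX z n : normc (z ^+ n) = normc z ^+ n.
Proof.
elim: n => [|n IH]; first by rewrite !expr0 ComplexField.Normc.normc1.
by rewrite !exprS ComplexField.Normc.normcM IH.
Qed.

Lemma sqr_normcE z : normc z ^+ 2 = complex.Re z ^+ 2 + complex.Im z ^+ 2.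
Proof. by case: z => x y /=; rewrite sqr_sqrtr// addr_ge0 ?sqr_ge0. Qed.

Lemma ler_Re_normc z : `|complex.Re z| <= normc z.
Proof.
rewrite -(ler_pXn2r (n := 2)) ?nnegrE ?normc_ge0//.
by rewrite sqr_normcE real_normK ?num_real// lerDl sqr_ge0.
Qed.

Lemma ler_Im_normc z : `|complex.Im z| <= normc z.
Proof.
rewrite -(ler_pXn2r (n := 2)) ?nnegrE ?normc_ge0//.
by rewrite sqr_normcE real_normK ?num_real// lerDr sqr_ge0.
Qed.

Lemma ler_normc_ReIm z : normc z <= `|complex.Re z| + `|complex.Im z|.
Proof.
rewrite -(ler_pXn2r (n := 2)) ?nnegrE ?normc_ge0 ?addr_ge0//.
rewrite sqr_normcE sqrrD !real_normK ?num_real//.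
by rewrite addrAC lerDl mulrn_wge0// mulr_ge0.
Qed.

Lemma normcJ z : normc z^* = normc z.
Proof. by case: z => x y /=; rewrite sqrrN. Qed.

Lemma normcB z w : normc (z - w) = normc (w - z).
Proof. by rewrite -normcN opprB. Qed.

Lemma ler_normcB z w : normc z - normc w <= normc (z - w).
Proof. by rewrite lerBlDr -{1}(subrK w z) le_normcD. Qed.

(** The norm of [R[i]] takes its values in [R[i]], so balls have complex radii. A positive complex
    number is real, and its real part serves as a radius in [R]. *)
Lemma nbhs_normc (z : R[i]) (P : set R[i]) :
  nbhs (z : C) P <-> exists2 d : R, 0 < d & forall w, normc (w - z) < d -> P w.
Proof.
split.
  move=> /(@nbhs_normP R[i] R[i]^o z P)[e /= e0 eP].
  have eR : e = (complex.Re e)%:C by rewrite RRe_real// gtr0_real.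
  exists (complex.Re e); first by rewrite -ltcR -eR.
  move=> w wd; apply: eP => /=.
  by rewrite distrC norm_normc eR ltcR.
move=> [d d0 dP]; apply/(@nbhs_normP R[i] R[i]^o z P); exists d%:C => /=; first by rewrite ltcR.
by move=> w /=; rewrite distrC norm_normc ltcR; exact: dP.
Qed.

Lemma cvg_normc (T : topologicalType) (F : set_system T) {FF : Filter F}
    (f : T -> R[i]) (l : R[i]) :
  (f : T -> C) x @[x --> F] --> (l : C) <->
  forall e : R, 0 < e -> \forall x \near F, normc (f x - l) < e.
Proof.
split => [fl e e0|H].
  by apply: (fl [set w | normc (w - l) < e]); apply/nbhs_normc; exists e.
by move=> P /nbhs_normc[d d0 dP]; near do apply: dP; exact: H.
Unshelve. all: by end_near. Qed.

(** Written without division, the estimate also holds at [w = z], so no punctured neighborhood has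
    to be carried along. *)
Lemma derivable_normc f z : derivable (f : C -> C) z 1 <->
  exists l, forall e : R, 0 < e -> exists2 d : R, 0 < d & forall w,
    normc (w - z) < d -> normc (f w - f z - l * (w - z)) <= e * normc (w - z).
Proof.
split.
  move=> /cvg_ex[/= l /cvgrPdist_lt H]; exists l => e e0.
  have e0' : (0 : R[i]) < e%:C by rewrite ltcR.
  have /= := H _ e0'; rewrite near_withinE => /nbhs_normc[d d0 dP].
  exists d => // w wd.
  have [->|wz] := eqVneq w z.
    by rewrite !subrr mulr0 subrr ComplexField.Normc.normc0 mulr0.
  have wz0 : w - z != 0 by rewrite subr_eq0.
  have := dP (w - z); rewrite subr0 => /(_ wd wz0).
  rewrite scaler1 /= subrK.
  rewrite norm_normc ltcR => lt1.
  rewrite (_ : f w - f z - l * (w - z) =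
     - (l - (w - z)^-1 * (f w - f z)) * (w - z)); last by field.
  by rewrite ComplexField.Normc.normcM normcN ler_wpM2r ?normc_ge0// ltW.
move=> [l H]; apply/cvg_ex; exists l => /=.
apply/cvgrPdist_lt => e e0; rewrite near_withinE.
have eR : e = (complex.Re e)%:C by rewrite RRe_real// gtr0_real.
(* Halving turns the non-strict estimate into the strict inequality that the limit asks for. *)
have e0' : 0 < complex.Re e / 2 by rewrite divr_gt0// -ltcR -eR.
have [d d0 dP] := H _ e0'.
apply/nbhs_normc; exists d => // h; rewrite subr0 => hd h0.
rewrite scaler1.
have := dP (h + z); rewrite addrK => /(_ hd).
rewrite norm_normc eR ltcR => le1.
rewrite (_ : l - _ = - (f (h + z) - f z - l * h) * h^-1); last first.
  by rewrite /= /GRing.scale /=; field.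
rewrite ComplexField.Normc.normcM normcN ComplexField.Normc.normcV.
rewrite ltr_pdivrMr ?normc_gt0//; apply: le_lt_trans le1 _.
by rewrite ltr_pM2r ?normc_gt0//; rewrite ltr_pdivrMr// ltr_pMr ?ltr1n// -ltcR -eR.
Qed.

Lemma continuous_Re : continuous (@complex.Re R : C -> R).
Proof.
move=> z; apply/(@cvgrPdist_lt _ _ _ (nbhs (z : C))) => e e0.
apply/nbhs_normc; exists e => // w wz.
by rewrite -raddfB; apply: le_lt_trans (ler_Re_normc _) _; rewrite normcB.
Qed.

Lemma continuous_Im : continuous (@complex.Im R : C -> R).
Proof.
move=> z; apply/(@cvgrPdist_lt _ _ _ (nbhs (z : C))) => e e0.
apply/nbhs_normc; exists e => // w wz.
by rewrite -raddfB; apply: le_lt_trans (ler_Im_normc _) _; rewrite normcB.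
Qed.

Lemma continuous_conjc : continuous (@conjc R : C -> C).
Proof.
move=> z; apply/(@cvg_normc _ (nbhs (z : C))) => e e0; apply/nbhs_normc; exists e => // w wz.
by rewrite -(rmorphB (@conjc R)) normcJ.
Qed.

Lemma continuous_hline (y : R) : continuous (fun x : R => (x +i* y : C)).
Proof.
move=> x; apply/cvg_normc => e e0; near=> t.
apply: le_lt_trans (ler_normc_ReIm _) _ => /=.
rewrite subrr normr0 addr0 distrC; near: t.
exact: cvgr_dist_lt.
Unshelve. all: by end_near. Qed.

Lemma continuous_vline (x : R) : continuous (fun y : R => (x +i* y : C)).
Proof.
move=> y; apply/cvg_normc => e e0; near=> t.
apply: le_lt_trans (ler_normc_ReIm _) _ => /=.
rewrite subrr normr0 add0r distrC; near: t.
exact: cvgr_dist_lt.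
Unshelve. all: by end_near. Qed.

Lemma derivable_continuous f z :
  derivable (f : C -> C) z 1 -> {for z, continuous (f : C -> C)}.
Proof. by move=> /derivable1_diffP /differentiable_continuous. Qed.

End ComplexPlane.

(** * Integrals of complex-valued functions *)

Section ComplexIntegral.
Context {d : measure_display} {T : measurableType d} {R : realType}.
Variables (mu : {measure set T -> \bar R}) (D : set T).
Hypothesis mD : measurable D.
Implicit Types u v : T -> R[i].

(** Over the area measure this is convertible with [Cintegral], so everything proved here applies to
    [wdot]; over an interval it serves for contours. *)
Definition cint u : R[i] :=
  (\int[mu]_(t in D) complex.Re (u t))%R +i*
  (\int[mu]_(t in D) complex.Im (u t))%R.

Definition cintegrable u :=
  mu.-integrable D (EFin \o (fun t => complex.Re (u t))) /\
  mu.-integrable D (EFin \o (fun t => complex.Im (u t))).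

Lemma eq_cint u v : (forall t, D t -> u t = v t) -> cint u = cint v.
Proof.
move=> uv; rewrite /cint.
by congr (_ +i* _); apply: eq_Rintegral => t /set_mem Dt; rewrite uv.
Qed.

Lemma cintD u v : cintegrable u -> cintegrable v ->
  cint (fun t => u t + v t) = cint u + cint v.
Proof.
move=> [u1 u2] [v1 v2]; rewrite /cint.
under eq_Rintegral do rewrite raddfD.
under [X in _ +i* X]eq_Rintegral do rewrite raddfD.
by rewrite !RintegralD.
Qed.

Lemma cintegrableZ (k : R[i]) u : cintegrable u ->
  cintegrable (fun t => k * u t).
Proof.
case: k => p q [u1 u2]; split.
  have := integrableD mD (integrableZl mD p u1) (integrableZl mD (- q) u2).
  apply: eq_integrable => // t _ /=.
  by case: (u t) => x y /=; rewrite EFinB EFinM EFinN mulNe EFinM.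
have := integrableD mD (integrableZl mD p u2) (integrableZl mD q u1).
apply: eq_integrable => // t _ /=.
by case: (u t) => x y /=; rewrite EFinD !EFinM.
Qed.

Lemma cintZ (k : R[i]) u : cintegrable u ->
  cint (fun t => k * u t) = k * cint u.
Proof.
case: k => p q [u1 u2]; rewrite /cint.
under eq_Rintegral => t _.
  rewrite (_ : complex.Re _ = p * complex.Re (u t) - q * complex.Im (u t)); last first.
    by case: (u t).
  over.
under [X in _ +i* X]eq_Rintegral => t _.
  rewrite (_ : complex.Im _ = p * complex.Im (u t) + q * complex.Re (u t)); last first.
    by case: (u t).
  over.
have iZ r w : mu.-integrable D (EFin \o w) ->
    mu.-integrable D (EFin \o (fun t => r * w t)).
  move=> iw; have := integrableZl mD r iw.
  by apply: eq_integrable => // t _ /=; rewrite EFinM.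
rewrite RintegralB ?RintegralD//; try exact: iZ.
by rewrite !RintegralZl.
Qed.

Lemma cintB u v : cintegrable u -> cintegrable v ->
  cint (fun t => u t - v t) = cint u - cint v.
Proof.
move=> iu iv.
rewrite -mulN1r -cintZ// -cintD//; last exact: cintegrableZ.
by apply: eq_cint => t _; rewrite mulN1r.
Qed.

Lemma cint_conj u : cintegrable u -> cint (fun t => (u t)^*) = (cint u)^*.
Proof.
move=> [u1 u2]; rewrite /cint /=.
congr (_ +i* _); first by apply: eq_Rintegral => t _; case: (u t).
rewrite -mulN1r -RintegralZl//.
by apply: eq_Rintegral => t _; case: (u t) => x y /=; rewrite mulN1r.
Qed.

(** The factor 2 comes from bounding the real and imaginary parts separately; the sharp constant is
    irrelevant for the limits below. *)
Lemma normc_cint_le u (M : R) : (mu D < +oo)%E -> cintegrable u ->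
  (forall t, D t -> normc (u t) <= M) -> normc (cint u) <= 2 * M * fine (mu D).
Proof.
move=> muD [u1 u2] uM.
have Mint : mu.-integrable D (EFin \o cst M).
  apply: measurable_bounded_integrable => //.
  exact: bounded_cst.
have step (w : T -> R) : mu.-integrable D (EFin \o w) ->
    (forall t, D t -> `|w t| <= M) ->
    `|\int[mu]_(t in D) w t| <= M * fine (mu D).
  move=> iw wM; apply: le_trans (le_normr_Rintegral mD iw) _.
  rewrite -(Rintegral_cst mu mD); apply: le_Rintegral => //.
  have := integrable_abse iw.
  by apply: eq_integrable => // t _ /=.
apply: le_trans (ler_normc_ReIm _) _ => /=.
rewrite -mulrA mulr_natl mulr2n lerD// step// => t Dt.
  exact: le_trans (ler_Re_normc _) (uM _ Dt).
exact: le_trans (ler_Im_normc _) (uM _ Dt).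
Qed.

End ComplexIntegral.

(** * Integrals over the boundary of a rectangle *)

Section Contour.
Context {R : realType}.
Local Notation C := (R[i]^o).
Local Notation mu := (@lebesgue_measure R).
Implicit Types (a b c d m x y M : R) (z w k : R[i]) (f g : R[i] -> R[i]).

Lemma continuous_cintegrable a b (u : R -> R[i]) :
  (forall t, a <= t <= b -> {for t, continuous (u : R -> C)}) ->
  cintegrable mu `[a, b]%classic u.
Proof.
move=> uc; split; apply: continuous_compact_integrable => //;
  try exact: segment_compact;
  apply: continuous_in_subspaceT => t /set_mem /=; rewrite in_itv /= => tab.
  by apply: (@continuous_comp _ _ _ (u : R -> C) (@complex.Re R));
    [exact: uc|exact: continuous_Re].
by apply: (@continuous_comp _ _ _ (u : R -> C) (@complex.Im R));
    [exact: uc|exact: continuous_Im].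
Qed.

Lemma fine_lebesgue_segment a b : a <= b -> fine (mu `[a, b]%classic) = b - a.
Proof.
move=> ab; rewrite lebesgue_measure_itv /= lte_fin.
by case: ltP => //= ba; apply/esym/eqP; rewrite subr_eq0 eq_le ab ba.
Qed.

Lemma lebesgue_segment_lty a b : (mu `[a, b]%classic < +oo)%E.
Proof. by rewrite lebesgue_measure_itv /=; case: ifP => _; rewrite -?EFinB ltry. Qed.

Lemma normc_segment_cint_le a b M (u : R -> R[i]) : a <= b ->
  cintegrable mu `[a, b]%classic u ->
  (forall t, a <= t <= b -> normc (u t) <= M) ->
  normc (cint mu `[a, b]%classic u) <= 2 * M * (b - a).
Proof.
move=> ab iu uM; rewrite -(fine_lebesgue_segment ab).
by apply: normc_cint_le => //; exact: lebesgue_segment_lty.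
Qed.

Lemma cint_segment_cst a b k : a <= b ->
  cint mu `[a, b]%classic (fun=> k) = (b - a)%:C * k.
Proof.
move=> ab; rewrite /cint !Rintegral_cst// fine_lebesgue_segment//.
by case: k => p q /=; simpc; rewrite ![(b - a) * _]mulrC.
Qed.

Lemma cint_segment_split a b m (u : R -> R[i]) : a <= m <= b ->
  cintegrable mu `[a, b]%classic u ->
  cint mu `[a, b]%classic u =
  cint mu `[a, m]%classic u + cint mu `[m, b]%classic u.
Proof.
move=> /andP[am mb] [u1 u2].
have split (v : R -> R) : mu.-integrable `[a, b]%classic (EFin \o v) ->
    (\int[mu]_(t in `[a, b]%classic) v t =
     \int[mu]_(t in `[a, m]%classic) v t + \int[mu]_(t in `[m, b]%classic) v t)%R.
  (* The point [m] belongs to both pieces; as a null set it can be left out of the second one. *)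
  move=> iv; rewrite -(@Rintegral_itv_obnd_cbnd _ m); last first.
    by apply: integrableS iv => //; apply: subset_itvr; rewrite bnd_simp.
  by rewrite -(@Rintegral_itvB _ v (BLeft a) (BRight b) m iv) ?bnd_simp// subrKC.
by rewrite /cint !split.
Qed.

Definition box a b c d : set R[i] :=
  [set z | a <= complex.Re z <= b /\ c <= complex.Im z <= d].

Definition frame a b c d : set R[i] :=
  [set z | (a <= complex.Re z <= b /\ (complex.Im z = c \/ complex.Im z = d)) \/
           (c <= complex.Im z <= d /\ (complex.Re z = a \/ complex.Re z = b))].

Lemma frame_box a b c d : a <= b -> c <= d -> frame a b c d `<=` box a b c d.
Proof.
by move=> ab cd z [[h [e|e]]|[h [e|e]]]; split;
  rewrite ?h// e ?lexx ?ab ?cd.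
Qed.

(* Oriented counterclockwise. *)
Definition contour f a b c d : R[i] :=
  cint mu `[a, b]%classic (fun x => f (x +i* c)) -
  cint mu `[a, b]%classic (fun x => f (x +i* d)) +
  'i * (cint mu `[c, d]%classic (fun y => f (b +i* y)) -
        cint mu `[c, d]%classic (fun y => f (a +i* y))).

(** Continuity in the plane at each point of [A], which is stronger than continuity of the
    restriction to [A]; differentiability supplies it. *)
Definition continuous_on (A : set R[i]) f :=
  forall z, A z -> {for z, continuous (f : C -> C)}.

Lemma hline_cintegrable f a b y :
  (forall x, a <= x <= b -> {for (x +i* y), continuous (f : C -> C)}) ->
  cintegrable mu `[a, b]%classic (fun x => f (x +i* y)).
Proof.
move=> fc; apply: continuous_cintegrable => t tab.
by apply: (@continuous_comp _ _ _ (fun x : R => (x +i* y : C)) (f : C -> C));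
  [exact: continuous_hline|exact: fc].
Qed.

Lemma vline_cintegrable f c d x :
  (forall y, c <= y <= d -> {for (x +i* y), continuous (f : C -> C)}) ->
  cintegrable mu `[c, d]%classic (fun y => f (x +i* y)).
Proof.
move=> fc; apply: continuous_cintegrable => t tab.
by apply: (@continuous_comp _ _ _ (fun y : R => (x +i* y : C)) (f : C -> C));
  [exact: continuous_vline|exact: fc].
Qed.

Lemma frame_cintegrable a b c d f : continuous_on (frame a b c d) f ->
  [/\ cintegrable mu `[a, b]%classic (fun x => f (x +i* c)),
      cintegrable mu `[a, b]%classic (fun x => f (x +i* d)),
      cintegrable mu `[c, d]%classic (fun y => f (b +i* y)) &
      cintegrable mu `[c, d]%classic (fun y => f (a +i* y))].
Proof.
move=> fc; split; [apply: hline_cintegrable|apply: hline_cintegrable|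
  apply: vline_cintegrable|apply: vline_cintegrable] => t tab; apply: fc.
- by left; split => //=; left.
- by left; split => //=; right.
- by right; split => //=; right.
- by right; split => //=; left.
Qed.

Lemma eq_contour a b c d f g : (forall z, frame a b c d z -> f z = g z) ->
  contour f a b c d = contour g a b c d.
Proof.
move=> fg; rewrite /contour; congr (_ - _ + _ * (_ - _));
  apply: eq_cint => t /=; rewrite in_itv /= => tab; apply: fg.
- by left; split => //=; left.
- by left; split => //=; right.
- by right; split => //=; right.
- by right; split => //=; left.
Qed.

Lemma contourD a b c d f g : continuous_on (frame a b c d) f ->
  continuous_on (frame a b c d) g ->
  contour (fun z => f z + g z) a b c d = contour f a b c d + contour g a b c d.
Proof.
move=> /frame_cintegrable[f1 f2 f3 f4] /frame_cintegrable[g1 g2 g3 g4].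
by rewrite /contour !cintD//; ring.
Qed.

Lemma contourZ a b c d k f : continuous_on (frame a b c d) f ->
  contour (fun z => k * f z) a b c d = k * contour f a b c d.
Proof.
move=> /frame_cintegrable[f1 f2 f3 f4].
by rewrite /contour !cintZ//; ring.
Qed.

Lemma contourB a b c d f g : continuous_on (frame a b c d) f ->
  continuous_on (frame a b c d) g ->
  contour (fun z => f z - g z) a b c d = contour f a b c d - contour g a b c d.
Proof.
move=> /frame_cintegrable[f1 f2 f3 f4] /frame_cintegrable[g1 g2 g3 g4].
by rewrite /contour !cintB//; ring.
Qed.

(** Each length occurs on two opposite sides, and each side carries the factor 2 of
    [normc_segment_cint_le]. *)
Lemma contour_le a b c d f M : a <= b -> c <= d ->
  continuous_on (frame a b c d) f ->
  (forall z, frame a b c d z -> normc (f z) <= M) ->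
  normc (contour f a b c d) <= 4 * M * ((b - a) + (d - c)).
Proof.
move=> ab cd /frame_cintegrable[f1 f2 f3 f4] fM.
have n1 : normc ('i : R[i]) = 1.
  by rewrite /= expr0n /= add0r expr1n sqrtr1.
apply: le_trans (le_normcD _ _) _.
rewrite ComplexField.Normc.normcM n1 mul1r.
have {}f1 : normc (cint mu `[a, b]%classic (fun x => f (x +i* c))) <= 2 * M * (b - a).
  by apply: normc_segment_cint_le => // t tab; apply: fM; left; split => //=; left.
have {}f2 : normc (cint mu `[a, b]%classic (fun x => f (x +i* d))) <= 2 * M * (b - a).
  by apply: normc_segment_cint_le => // t tab; apply: fM; left; split => //=; right.
have {}f3 : normc (cint mu `[c, d]%classic (fun y => f (b +i* y))) <= 2 * M * (d - c).
  by apply: normc_segment_cint_le => // t tab; apply: fM; right; split => //=; right.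
have {}f4 : normc (cint mu `[c, d]%classic (fun y => f (a +i* y))) <= 2 * M * (d - c).
  by apply: normc_segment_cint_le => // t tab; apply: fM; right; split => //=; left.
rewrite (_ : 4 * M * _ = (2 * M * (b - a) + 2 * M * (b - a)) +
  (2 * M * (d - c) + 2 * M * (d - c))); last by ring.
by apply: lerD; apply: le_trans (le_normcD _ _) _; rewrite normcN lerD.
Qed.

Lemma contour_splitx m a b c d f : a <= m <= b -> c <= d ->
  continuous_on (frame a b c d) f ->
  contour f a b c d = contour f a m c d + contour f m b c d.
Proof.
move=> amb cd /frame_cintegrable[f1 f2 f3 f4].
by rewrite /contour !(cint_segment_split amb)//; ring.
Qed.

Lemma contour_splity m a b c d f : c <= m <= d -> a <= b ->
  continuous_on (frame a b c d) f ->
  contour f a b c d = contour f a b c m + contour f a b m d.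
Proof.
move=> cmd ab /frame_cintegrable[f1 f2 f3 f4].
by rewrite /contour !(cint_segment_split cmd)//; ring.
Qed.

Lemma continuous_cst_on (A : set R[i]) k : continuous_on A (fun=> k).
Proof. by move=> z _; exact: (@cst_continuous C C k z). Qed.

Lemma continuous_id_on (A : set R[i]) : continuous_on A id.
Proof. by move=> z _; exact: cvg_id. Qed.

Lemma contour_cst a b c d k : a <= b -> c <= d ->
  contour (fun=> k) a b c d = 0.
Proof. by move=> ab cd; rewrite /contour !subrr mulr0 addr0. Qed.

(** On opposite sides the integrands differ by a constant, ['i * (c - d)] for the horizontal sides
    and [b - a] for the vertical ones. The two contributions cancel, and no antiderivative is
    involved. *)
Lemma contour_id a b c d : a <= b -> c <= d -> contour id a b c d = 0.
Proof.
move=> ab cd.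
have [f1 f2 f3 f4] := frame_cintegrable (@continuous_id_on (frame a b c d)).
rewrite /contour -!cintB//.
rewrite (@eq_cint _ _ _ _ _ _ (fun=> (0 +i* (c - d)))); last first.
  by move=> t _; apply/eqP; rewrite eq_complex /=; apply/andP; split; apply/eqP; ring.
rewrite (@eq_cint _ _ _ mu _ (fun t => (b +i* t) - _) (fun=> (b - a)%:C)); last first.
  by move=> t _; apply/eqP; rewrite eq_complex /=; apply/andP; split; apply/eqP; ring.
rewrite !cint_segment_cst//; simpc.
by apply/eqP; rewrite eq_complex /=; apply/andP; split; apply/eqP; ring.
Qed.

(** This allows the first-order approximation of a function to be subtracted under the integral in
    Goursat's lemma. *)
Lemma contour_affine a b c d k l : a <= b -> c <= d ->
  contour (fun z => k + l * z) a b c d = 0.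
Proof.
move=> ab cd.
have cZ : continuous_on (frame a b c d) (fun z => l * z).
  by move=> z _; exact: (@mulrl_continuous R[i] l z).
rewrite (contourD (@continuous_cst_on _ k) cZ).
rewrite contour_cst// (contourZ l (@continuous_id_on _)).
by rewrite contour_id// mulr0 addr0.
Qed.

End Contour.

(** * Goursat's lemma *)

Section Bisection.
Context {R : realType}.
Local Notation C := (R[i]^o).
Implicit Types (a b c d m x y e M : R) (z w k : R[i]) (f g : R[i] -> R[i]).

Definition subrect (a b c d a' b' c' d' : R) :=
  [/\ a <= a', a' < b', b' <= b, c <= c' & c' < d' /\ d' <= d].

(** If [P] failed, some quarter would fail too, and so on. The nested failing boxes shrink to a
    point, where the local hypothesis contradicts the failure of a small enough one. *)
Lemma bisection (P : R -> R -> R -> R -> Prop) a b c d : a < b -> c < d ->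
  (forall a' b' c' d', subrect a b c d a' b' c' d' ->
    let m := (a' + b') / 2 in let n := (c' + d') / 2 in
    P a' m c' n -> P m b' c' n -> P a' m n d' -> P m b' n d' ->
    P a' b' c' d') ->
  (forall x y, a <= x <= b -> c <= y <= d -> exists2 e, 0 < e &
    forall a' b' c' d', subrect a b c d a' b' c' d' ->
      a' <= x <= b' -> c' <= y <= d' -> b' - a' < e -> d' - c' < e ->
      P a' b' c' d') ->
  P a b c d.
Proof.
move=> ab cd step local; apply: contrapT => nP.
pose bad (s : R * R * R * R) := let: (a', b', c', d') := s in
  subrect a b c d a' b' c' d' /\ ~ P a' b' c' d'.
pose child (s s' : R * R * R * R) :=
  let: (a', b', c', d') := s in let: (a1, b1, c1, d1) := s' in
  [/\ a' <= a1, b1 <= b', c' <= c1, d1 <= d' &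
      b1 - a1 = (b' - a') / 2 /\ d1 - c1 = (d' - c') / 2].
(* A bad box has a bad quarter. The selection function is total; its value on a box that is not bad
   is arbitrary. *)
have /choice[F FP] : forall s, exists s', bad s -> bad s' /\ child s s'.
  move=> [[[a' b'] c'] d'].
  have [[sr nP']|nb] := pselect (bad (a', b', c', d')); last first.
    by exists (a', b', c', d') => /nb.
  case: (sr) => aa' ab' bb' cc' [cd' dd'].
  have step' := step _ _ _ _ sr.
  set m := (a' + b') / 2 in step' *; set n := (c' + d') / 2 in step' *.
  have am : a' < m by rewrite /m; lra.
  have mb : m < b' by rewrite /m; lra.
  have cn : c' < n by rewrite /n; lra.
  have nd : n < d' by rewrite /n; lra.
  have [p1|p1] := pselect (P a' m c' n); last first.
    exists (a', m, c', n) => _; split; [split => //; split; lra|].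
    by split; rewrite /m /n; try split; lra.
  have [p2|p2] := pselect (P m b' c' n); last first.
    exists (m, b', c', n) => _; split; [split => //; split; lra|].
    by split; rewrite /m /n; try split; lra.
  have [p3|p3] := pselect (P a' m n d'); last first.
    exists (a', m, n, d') => _; split; [split => //; split; lra|].
    by split; rewrite /m /n; try split; lra.
  have [p4|p4] := pselect (P m b' n d'); last first.
    exists (m, b', n, d') => _; split; [split => //; split; lra|].
    by split; rewrite /m /n; try split; lra.
  by exfalso; exact/nP'/step'.
pose s n := iter n F (a, b, c, d).
pose A n := (s n).1.1.1; pose B n := (s n).1.1.2.
pose A' n := (s n).1.2; pose B' n := (s n).2.
have sE n : s n = (A n, B n, A' n, B' n).
  by rewrite /A /B /A' /B'; case: (s n) => [[[? ?] ?] ?].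
have sbad n : bad (s n).
  elim: n => [|n IH]; last by rewrite /s iterS; exact: (FP _ IH).1.
  by split => //; split.
have schild n : child (s n) (s n.+1).
  by rewrite [s n.+1]/s iterS; exact: (FP _ (sbad n)).2.
have An n : [/\ A n <= A n.+1, B n.+1 <= B n, A' n <= A' n.+1, B' n.+1 <= B' n &
    B n.+1 - A n.+1 = (B n - A n) / 2 /\
    B' n.+1 - A' n.+1 = (B' n - A' n) / 2].
  by have := schild n; rewrite (sE n) (sE n.+1).
have srn n : subrect a b c d (A n) (B n) (A' n) (B' n).
  by have := sbad n; rewrite (sE n) => -[].
have nPn n : ~ P (A n) (B n) (A' n) (B' n).
  by have := sbad n; rewrite (sE n) => -[].
have size n : B n - A n = (b - a) / 2 ^+ n /\ B' n - A' n = (d - c) / 2 ^+ n.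
  elim: n => [|n [IH1 IH2]]; first by rewrite expr0 !divr1.
  have [_ _ _ _ [-> ->]] := An n.
  by rewrite IH1 IH2 exprSr invfM !mulrA.
(* Nested intervals have a common point, the supremum of the left endpoints. *)
have limit (u v : nat -> R) : (forall n, u n <= u n.+1) ->
    (forall n, v n.+1 <= v n) -> (forall n, u n < v n) ->
    exists x, forall n, u n <= x <= v n.
  move=> uS vS uv.
  have um (m n : nat) : (m <= n)%N -> u m <= u n.
    move=> /subnK <-; elim: (n - m)%N => [|k IH]; first by rewrite add0n.
    by rewrite addSn; exact: le_trans IH (uS _).
  have vm (m n : nat) : (m <= n)%N -> v n <= v m.
    move=> /subnK <-; elim: (n - m)%N => [|k IH]; first by rewrite add0n.
    by rewrite addSn; exact: le_trans (vS _) IH.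
  have ub n : ubound (range u) (v n).
    move=> _ [m _ <-]; have [mn|/ltnW nm] := leqP m n.
      by apply: le_trans (um _ _ mn) _; exact: ltW.
    by apply: le_trans (vm _ _ nm); exact: ltW.
  exists (sup (range u)) => n; apply/andP; split.
    by apply: ub_le_sup; [exists (v 0%N); exact: ub|exists n].
  by apply: ge_sup => //; exists (u 0%N); exists 0%N.
have [x xP] : exists x, forall n, A n <= x <= B n.
  apply: limit => n; [by have [] := An n|by have [] := An n|].
  by have [] := srn n.
have [y yP] : exists y, forall n, A' n <= y <= B' n.
  apply: limit => n; [by have [] := An n|by have [] := An n|].
  by have [_ _ _ _ []] := srn n.
have [e e0 eP] := local x y (xP 0%N) (yP 0%N).
(* By the Archimedean property some [n] exceeds the sum of the sides over [e], and [n < 2 ^+ n]. *)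
have [n [n1 n2]] : exists n, (b - a) / 2 ^+ n < e /\ (d - c) / 2 ^+ n < e.
  exists (Num.bound ((b - a + (d - c)) / e)).
  set n := Num.bound _.
  have lt1 : (b - a + (d - c)) / e < n%:R.
    by apply: archi_boundP; rewrite divr_ge0 ?ltW//; lra.
  have lt2 : n%:R < 2 ^+ n :> R by rewrite -natrX ltr_nat ltn_expl.
  have : b - a + (d - c) < e * 2 ^+ n.
    by rewrite mulrC -ltr_pdivrMr//; exact: lt_trans lt1 lt2.
  by move=> h; split; rewrite ltr_pdivrMr ?exprn_gt0//; lra.
have [s1 s2] := size n.
by apply: (nPn n); apply: eP; rewrite ?s1 ?s2.
Qed.

End Bisection.

Section Goursat.
Context {R : realType}.
Local Notation C := (R[i]^o).
Implicit Types (a b c d m x y e M : R) (z w k : R[i]) (f g : R[i] -> R[i]).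

Lemma box_subrect a b c d a' b' c' d' : subrect a b c d a' b' c' d' ->
  box a' b' c' d' `<=` box a b c d.
Proof.
by move=> [? ? ? ? [? ?]] z [/andP[? ?] /andP[? ?]]; split; apply/andP; split; lra.
Qed.

Lemma contour_split4 a b c d m n f : a <= m <= b -> c <= n <= d ->
  continuous_on (box a b c d) f ->
  contour f a b c d = contour f a m c n + contour f m b c n +
                      contour f a m n d + contour f m b n d.
Proof.
move=> amb cnd fc.
have [/andP[am mb] /andP[cn nd]] := (amb, cnd).
have sub a' b' c' d' : a <= a' -> a' <= b' -> b' <= b -> c <= c' -> c' <= d' ->
    d' <= d -> continuous_on (frame a' b' c' d') f.
  move=> ? ? ? ? ? ? z /frame_box H; apply: fc.
  by have [//|//|/andP[? ?] /andP[? ?]] := H _ _; split; apply/andP; split; lra.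
rewrite (contour_splitx amb); [|lra|by apply: sub; lra].
rewrite (@contour_splity _ n a m c d)//; last by apply: sub; lra.
rewrite (@contour_splity _ n m b c d)//; last by apply: sub; lra.
by rewrite addrACA !addrA.
Qed.

(* The bound [e * p ^+ 2], with [p] the half-perimeter, is additive under cutting a
   box into four equal quarters, so it can be proved by bisection. *)
Lemma goursat a b c d f : a < b -> c < d ->
  (forall z, box a b c d z -> derivable (f : C -> C) z 1) ->
  contour f a b c d = 0.
Proof.
move=> ab cd df.
have fc : continuous_on (box a b c d) f.
  by move=> z /df; exact: derivable_continuous.
have main e : 0 < e -> normc (contour f a b c d) <= e * (b - a + (d - c)) ^+ 2.
  move=> e0; pose P a' b' c' d' :=
    normc (contour f a' b' c' d') <= e * (b' - a' + (d' - c')) ^+ 2.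
  apply: (@bisection _ P) => // [a' b' c' d' sr m n P1 P2 P3 P4|x y xab ycd].
    have [h1 h2 h3 h4 [h5 h6]] := sr.
    rewrite /P (@contour_split4 a' b' c' d' m n); last 3 first.
    - by rewrite /m; apply/andP; split; lra.
    - by rewrite /n; apply/andP; split; lra.
    - by move=> z /(box_subrect sr) /fc.
    do 3! (apply: le_trans (le_normcD _ _) _; rewrite -?lerBrDr).
    move: P1 P2 P3 P4; rewrite /P /m /n; set u := b' - a'; set v := d' - c'.
    have -> : (a' + b') / 2 - a' = u / 2 by rewrite /u; lra.
    have -> : b' - (a' + b') / 2 = u / 2 by rewrite /u; lra.
    have -> : (c' + d') / 2 - c' = v / 2 by rewrite /v; lra.
    have -> : d' - (c' + d') / 2 = v / 2 by rewrite /v; lra.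
    have -> : e * (u / 2 + v / 2) ^+ 2 = e * (u + v) ^+ 2 / 4 by field.
    lra.
  (* Near the common point [f] is affine up to [e / 4] times the distance. The affine part
     integrates to 0, and the 4 cancels against the constant of [contour_le]. *)
  have /derivable_normc[l lP] := df (x +i* y) (conj xab ycd).
  have e4 : 0 < e / 4 by rewrite divr_gt0.
  have [r r0 rP] := lP _ e4.
  (* Sides below [r / 2] keep the half-perimeter [s], which bounds the distance to the point, below
     [r]. *)
  exists (r / 2); first by rewrite divr_gt0.
  move=> a' b' c' d' sr xab' ycd' br dr.
  have [h1 h2 h3 h4 [h5 h6]] := sr.
  set s := b' - a' + (d' - c').
  have near_z z : frame a' b' c' d' z -> normc (z - (x +i* y)) <= s.
    move=> /(frame_box (ltW h2) (ltW h5)) [za zc].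
    apply: le_trans (ler_normc_ReIm _) _.
    rewrite !raddfB /= /s; apply: lerD; rewrite ler_norml; apply/andP; split; lra.
  pose k := f (x +i* y) - l * (x +i* y).
  have cA : continuous_on (frame a' b' c' d') (fun z => k + l * z).
    move=> z _; apply: (@continuousD _ C C (fun=> k) (fun z => l * z)).
      exact: (@cst_continuous C C k z).
    exact: (@mulrl_continuous R[i] l z).
  have cF : continuous_on (frame a' b' c' d') f.
    by move=> z /(frame_box (ltW h2) (ltW h5)) /(box_subrect sr) /fc.
  rewrite /P; have -> : contour f a' b' c' d' = contour (fun z => f z - (k + l * z)) a' b' c' d'.
    by rewrite (contourB cF cA) contour_affine ?subr0 ?ltW.
  have s0 : 0 <= s by rewrite /s; lra.
  rewrite (_ : e * s ^+ 2 = 4 * (e / 4 * s) * (b' - a' + (d' - c'))); last first.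
    by rewrite -/s; field.
  apply: contour_le; [exact: ltW|exact: ltW| |].
    by move=> z fz; apply: (@continuousB _ C C f (fun z => k + l * z));
      [exact: cF|exact: cA].
  move=> z fz; have zs := near_z _ fz.
  rewrite (_ : f z - (k + l * z) = f z - f (x +i* y) - l * (z - (x +i* y)));
    last by rewrite /k; ring.
  apply: le_trans (rP z _) _; last by rewrite ler_pM2l.
  by apply: le_lt_trans zs _; rewrite /s; lra.
apply/eqP; rewrite -normc_eq0; apply/contraT => n0.
have npos : 0 < normc (contour f a b c d) by rewrite lt_def n0 normc_ge0.
set t := b - a + (d - c) in main.
have t0 : 0 < t by rewrite /t; lra.
(* This choice of [e] bounds the positive norm by half of itself. *)
have := main (normc (contour f a b c d) / (2 * t ^+ 2)).
rewrite divr_gt0 ?mulr_gt0 ?exprn_gt0// => /(_ isT).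
rewrite (_ : _ / _ * _ = normc (contour f a b c d) / 2); last by field; lra.
lra.
Qed.

End Goursat.

(** * Cauchy's formula and removable singularities *)

Section CauchyFormula.
Context {R : realType}.
Local Notation C := (R[i]^o).
Implicit Types (a b c d x y e M : R) (z w k : R[i]) (f g : R[i] -> R[i]).

Lemma derivable_invB w z : z != w ->
  derivable ((fun t => (t - w)^-1) : C -> C) z 1.
Proof.
move=> zw; apply: (@derivableV _ C (fun t : C => t - w)).
  by rewrite subr_eq0.
by apply: derivableB; [exact: derivable_id|exact: derivable_cst].
Qed.

Lemma frame_neq a b c d x y z : a < x < b -> c < y < d ->
  frame a b c d z -> z != x +i* y.
Proof.
move=> /andP[ax xb] /andP[cy yd] fz; apply/negP => /eqP zE.
by move: fz; rewrite zE => -[] [_ [|]] /= e; move: ax xb cy yd;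
  rewrite e ltxx.
Qed.

(** Goursat's lemma applies to the four boxes around a small square centered at the exceptional
    point, so only the square contributes. There boundedness makes the integral at most a constant
    times the side length. *)
Lemma goursat_punctured a b c d x y f M : a < x < b -> c < y < d ->
  (forall z, box a b c d z -> z != x +i* y -> derivable (f : C -> C) z 1) ->
  (\forall z \near (x +i* y : C), normc (f z) <= M) ->
  contour f a b c d = 0.
Proof.
move=> /andP[ax xb] /andP[cy yd] df /nbhs_normc[r r0 fM].
have zero a' b' c' d' : a <= a' -> a' < b' -> b' <= b ->
    c <= c' -> c' < d' -> d' <= d ->
    [\/ b' < x, x < a', d' < y | y < c'] -> contour f a' b' c' d' = 0.
  move=> h1 h2 h3 h4 h5 h6 out.
  have sr : subrect a b c d a' b' c' d' by [].
  apply: goursat => // z zb; apply: df; first exact: box_subrect sr _ zb.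
  apply/negP => /eqP zE; move: zb; rewrite zE => -[/= /andP[? ?] /andP[? ?]].
  by case: out; lra.
have cont a' b' c' d' : a <= a' -> a' < x -> x < b' -> b' <= b ->
    c <= c' -> c' < y -> y < d' -> d' <= d -> continuous_on (frame a' b' c' d') f.
  move=> h1 h2 h3 h4 h5 h6 h7 h8 z fz.
  have sr : subrect a b c d a' b' c' d' by split => //; [lra|split => //; lra].
  apply: derivable_continuous; apply: df.
    by apply: box_subrect sr _ _; apply: frame_box fz; lra.
  by apply: frame_neq fz; apply/andP; split.
pose m := Num.min (Num.min (x - a) (b - x)) (Num.min (y - c) (d - y)).
have m0 : 0 < m by rewrite !lt_min !subr_gt0 ax xb cy yd.
have [m1 m2 m3 m4] : [/\ m <= x - a, m <= b - x, m <= y - c & m <= d - y].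
  by rewrite !ge_min !lexx !orbT.
have main e : 0 < e -> e < m -> 2 * e < r -> normc (contour f a b c d) <= 16 * M * e.
  move=> e0 em er.
  have -> : contour f a b c d = contour f (x - e) (x + e) (y - e) (y + e).
    (* The left, right, bottom and top boxes are cut off in this order, and each has integral 0. *)
    rewrite (@contour_splitx _ (x - e)); [|lra|lra|by apply: cont; lra].
    rewrite (zero a (x - e) c d); [rewrite add0r|lra|lra|lra|lra|lra|lra|by constructor 1; lra].
    rewrite (@contour_splitx _ (x + e)); [|lra|lra|by apply: cont; lra].
    rewrite (zero (x + e) b c d); [rewrite addr0|lra|lra|lra|lra|lra|lra|by constructor 2; lra].
    rewrite (@contour_splity _ (y - e)); [|lra|lra|by apply: cont; lra].
    rewrite (zero _ _ c (y - e)); [rewrite add0r|lra|lra|lra|lra|lra|lra|by constructor 3; lra].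
    rewrite (@contour_splity _ (y + e)); [|lra|lra|by apply: cont; lra].
    rewrite (zero _ _ (y + e) d); [by rewrite addr0|lra|lra|lra|lra|lra|lra|by constructor 4; lra].
  rewrite (_ : 16 * M * e = 4 * M * (x + e - (x - e) + (y + e - (y - e)))); last by ring.
  apply: contour_le; [lra|lra| |].
    by apply: cont; lra.
  move=> z zf; apply: fM; apply: le_lt_trans (ler_normc_ReIm _) _.
  have [||] := frame_box _ _ zf; [lra|lra|move=> /andP[? ?] /andP[? ?]].
  apply: le_lt_trans er; rewrite !raddfB /= mulr_natl mulr2n.
  by apply: lerD; rewrite ler_norml; apply/andP; split; lra.
apply/eqP; rewrite -normc_eq0; apply/contraT => n0.
have npos : 0 < normc (contour f a b c d) by rewrite lt_def n0 normc_ge0.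
set n := normc _ in main npos.
(* The first bound keeps the square inside the box, the second inside the disc where [f] is bounded,
   and the third makes [16 * M * e] at most [n / 2]. The [+ 1] avoids division by 0. *)
pose e := Num.min (m / 2) (Num.min (r / 3) (n / (32 * (`|M| + 1)))).
have M0 : 0 < `|M| + 1 by rewrite ltr_wpDl.
have e0 : 0 < e by rewrite !lt_min !divr_gt0// mulr_gt0.
have [e1 e2 e3] : [/\ e <= m / 2, e <= r / 3 & e <= n / (32 * (`|M| + 1))].
  by rewrite !ge_min !lexx !orbT.
have h1 : e < m by lra.
have h2 : 2 * e < r by lra.
have := main e e0 h1 h2.
move: e3; rewrite ler_pdivlMr ?mulr_gt0// => e3 h.
have : M * e <= (`|M| + 1) * e by rewrite ler_pM2r// ler_wpDr// ler_norm.
lra.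
Qed.

(* The difference quotient [(f z - f w) / (z - w)] has the junk value 0 at [w],
   but [goursat_punctured] only needs it to be bounded near [w]. *)
Lemma cauchy_formula a b c d x y f : a < x < b -> c < y < d ->
  (forall z, box a b c d z -> derivable (f : C -> C) z 1) ->
  contour (fun z => f z * (z - (x +i* y))^-1) a b c d =
  f (x +i* y) * contour (fun z => (z - (x +i* y))^-1) a b c d.
Proof.
move=> axb cyd df; set w := x +i* y.
have [/andP[ax xb] /andP[cy yd]] := (axb, cyd).
have bw : box a b c d w by split; apply/andP; split => /=; exact: ltW.
(* Tolerance 1 in the definition of the derivative bounds the difference quotient by [1 + normc l]
   near [w]. *)
have [l /(_ 1 ltr01)[r r0 lP]] := (derivable_normc _ _).1 (df _ bw).
have dg z : box a b c d z -> z != w ->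
    derivable ((fun z => (f z - f w) * (z - w)^-1) : C -> C) z 1.
  move=> bz zw; apply: (@derivableM _ C (fun t : C => f t - f w)).
    by apply: (@derivableB _ C C (f : C -> C)); [exact: df|exact: derivable_cst].
  exact: derivable_invB.
have ab : a <= b by lra.
have cd : c <= d by lra.
have ci : continuous_on (frame a b c d) (fun z => (z - w)^-1).
  move=> z fz; apply: derivable_continuous; apply: derivable_invB.
  exact: frame_neq axb cyd fz.
have cf : continuous_on (frame a b c d) (fun z => f z * (z - w)^-1).
  move=> z fz; apply: (@continuousM R[i] C (f : C -> C)); last exact: ci.
  by apply: derivable_continuous; apply: df; exact: frame_box fz.
have cw : continuous_on (frame a b c d) (fun z => f w * (z - w)^-1).
  move=> z fz; apply: (@continuousM R[i] C (fun=> f w)); last exact: ci.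
  exact: cst_continuous.
apply/eqP; rewrite -(contourZ (f w) ci) -subr_eq0 -(contourB cf cw).
rewrite (@eq_contour _ _ _ _ _ _ (fun z => (f z - f w) * (z - w)^-1)); last first.
  by move=> z _; rewrite mulrBl.
apply/eqP; apply: (@goursat_punctured _ _ _ _ x y _ (1 + normc l)) => //.
apply/nbhs_normc; exists r => // z zr.
have [->|zw] := eqVneq z w.
  by rewrite subrr mul0r ComplexField.Normc.normc0 addr_ge0 ?normc_ge0.
rewrite ComplexField.Normc.normcM ComplexField.Normc.normcV.
rewrite ler_pdivrMr ?normc_gt0 ?subr_eq0//.
rewrite -(subrK (l * (z - w)) (f z - f w)) mulrDl -ComplexField.Normc.normcM.
by apply: le_trans (le_normcD _ _) _; rewrite lerD2r; exact: lP.
Qed.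

End CauchyFormula.

(** * Expansion of Cauchy integrals over a square *)

Section CauchyExpansion.
Context {R : realType}.
Local Notation C := (R[i]^o).
Local Notation mu := (@lebesgue_measure R).
Implicit Types (a b c d x y s e M : R) (z w k u : R[i]) (f g h : R[i] -> R[i]).

Definition square_frame (z : R[i]) s : set R[i] :=
  frame (complex.Re z - s) (complex.Re z + s) (complex.Im z - s) (complex.Im z + s).

Definition square_contour f (z : R[i]) s : R[i] :=
  contour f (complex.Re z - s) (complex.Re z + s)
    (complex.Im z - s) (complex.Im z + s).

Lemma square_frame_ge z s w : 0 < s -> square_frame z s w -> s <= normc (w - z).
Proof.
move=> s0 fw.
have : s <= `|complex.Re (w - z)| \/ s <= `|complex.Im (w - z)|.
  rewrite !raddfB /=; case: fw => -[_ [|] ->]; [right|right|left|left];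
  by rewrite addrAC subrr add0r ?normrN ler_norm.
by case=> h; apply: le_trans h _; [exact: ler_Re_normc|exact: ler_Im_normc].
Qed.

Lemma segment_bounded a b (u : R -> R[i]) : a <= b ->
  (forall t, a <= t <= b -> {for t, continuous (u : R -> C)}) ->
  exists M, forall t, a <= t <= b -> normc (u t) <= M.
Proof.
move=> ab uc.
(* The extreme value theorem needs a real function; this one dominates the norm of [u]. *)
pose v t := `|complex.Re (u t)| + `|complex.Im (u t)|.
have vc : {within `[a, b], continuous v}.
  apply: continuous_in_subspaceT => t /set_mem /=; rewrite in_itv /= => tab.
  have Re_c : {for t, continuous (fun t => complex.Re (u t) : R^o)}.
    by apply: (@continuous_comp _ _ _ (u : R -> C) (@complex.Re R));
      [exact: uc|exact: continuous_Re].
  have Im_c : {for t, continuous (fun t => complex.Im (u t) : R^o)}.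
    by apply: (@continuous_comp _ _ _ (u : R -> C) (@complex.Im R));
      [exact: uc|exact: continuous_Im].
  by apply: cvgD; exact: cvg_norm.
have [t0 _ t0P] := EVT_max ab vc.
exists (v t0) => t tab; apply: le_trans (ler_normc_ReIm _) _.
by apply: t0P; rewrite in_itv.
Qed.

Lemma frame_bounded a b c d f : a <= b -> c <= d ->
  continuous_on (frame a b c d) f ->
  exists M, forall z, frame a b c d z -> normc (f z) <= M.
Proof.
move=> ab cd fc.
have hb y : y = c \/ y = d ->
    exists M, forall t, a <= t <= b -> normc (f (t +i* y)) <= M.
  move=> yE; apply: segment_bounded => // t tab.
  apply: (@continuous_comp _ _ _ (fun x : R => (x +i* y : C)) (f : C -> C));
    [exact: continuous_hline|by apply: fc; left].
have vb x : x = a \/ x = b ->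
    exists M, forall t, c <= t <= d -> normc (f (x +i* t)) <= M.
  move=> xE; apply: segment_bounded => // t tab.
  apply: (@continuous_comp _ _ _ (fun y : R => (x +i* y : C)) (f : C -> C));
    [exact: continuous_vline|by apply: fc; right].
have [M1 P1] := hb c (or_introl erefl); have [M2 P2] := hb d (or_intror erefl).
have [M3 P3] := vb a (or_introl erefl); have [M4 P4] := vb b (or_intror erefl).
exists (Num.max (Num.max M1 M2) (Num.max M3 M4)).
move=> [x y] [[/= h [|] e]|[/= h [|] e]]; rewrite e !le_max.
- by rewrite P1.
- by rewrite P2 ?orbT.
- by rewrite P3 ?orbT.
- by rewrite P4 ?orbT.
Qed.

(** With [v = t - z], integrate the finite geometric expansion [1/(v - u) = 1/v + u/v^2 + u^2/v^3 +
    u^3/(v^3 (v - u))] against [h]. On the frame [v] has norm at least [s] and [v - u] at least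
    [s / 2], which bounds the last term. Only continuity of [h] is used, so both [f] and the
    constant 1 qualify. *)
Lemma cauchy_integral_expansion (z : R[i]) s h : 0 < s ->
  continuous_on (square_frame z s) h ->
  exists n0 n1 n2 B, forall u, normc u <= s / 2 ->
    normc (square_contour (fun t => h t * (t - (z + u))^-1) z s -
           (n0 + n1 * u + n2 * u ^+ 2)) <= B * normc u ^+ 3.
Proof.
move=> s0 hc.
pose P t := (t - z)^-1.
have Pc : continuous_on (square_frame z s) P.
  move=> t /(square_frame_ge s0) ts; apply: derivable_continuous.
  by apply: derivable_invB; rewrite -subr_eq0 -normc_gt0; exact: lt_le_trans ts.
have mulc f g : continuous_on (square_frame z s) f ->
    continuous_on (square_frame z s) g ->
    continuous_on (square_frame z s) (fun t => f t * g t).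
  move=> fc gc t tf.
  by apply: (@continuousM R[i] C (f : C -> C) (g : C -> C)); [exact: fc|exact: gc].
have addc f g : continuous_on (square_frame z s) f ->
    continuous_on (square_frame z s) g ->
    continuous_on (square_frame z s) (fun t => f t + g t).
  move=> fc gc t tf.
  by apply: (@continuousD _ C C (f : C -> C) (g : C -> C)); [exact: fc|exact: gc].
have ss1 : complex.Re z - s <= complex.Re z + s by lra.
have ss2 : complex.Im z - s <= complex.Im z + s by lra.
have [M MP] := frame_bounded ss1 ss2 hc.
pose h1 t := h t * P t; pose h2 t := h1 t * P t; pose h3 t := h2 t * P t.
have h1c : continuous_on (square_frame z s) h1 by exact: mulc.
have h2c : continuous_on (square_frame z s) h2 by exact: mulc.
have h3c : continuous_on (square_frame z s) h3 by exact: mulc.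
exists (square_contour h1 z s), (square_contour h2 z s), (square_contour h3 z s).
(* [M / s ^+ 3 * (2 / s)] bounds the remainder integrand [r] below, and [4 * s] is the
   half-perimeter of the square. *)
exists (4 * (M / s ^+ 3 * (2 / s)) * (4 * s)) => u us.
pose Q t := (t - (z + u))^-1.
have Qge t : square_frame z s t -> s / 2 <= normc (t - (z + u)).
  move=> /(square_frame_ge s0) ts; rewrite opprD addrA.
  by apply: le_trans (ler_normcB _ _); lra.
have Qc : continuous_on (square_frame z s) Q.
  move=> t /Qge tq; apply: derivable_continuous; apply: derivable_invB.
  by rewrite -subr_eq0 -normc_gt0; apply: lt_le_trans tq; lra.
pose r t := h3 t * Q t.
have rc : continuous_on (square_frame z s) r by exact: mulc.
have cstc k : continuous_on (square_frame z s) (fun=> k).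
  exact: continuous_cst_on.
have -> : square_contour (fun t => h t * (t - (z + u))^-1) z s =
    square_contour h1 z s + square_contour h2 z s * u +
    square_contour h3 z s * u ^+ 2 + u ^+ 3 * square_contour r z s.
  rewrite [square_contour h2 z s * u]mulrC [square_contour h3 z s * _]mulrC.
  rewrite /square_contour -(contourZ u h2c) -(contourZ (u ^+ 2) h3c).
  rewrite -(contourZ (u ^+ 3) rc).
  have c2 := mulc _ _ (cstc u) h2c.
  have c3 := mulc _ _ (cstc (u ^+ 2)) h3c.
  have c4 := mulc _ _ (cstc (u ^+ 3)) rc.
  have c12 := addc _ _ h1c c2.
  have c123 := addc _ _ c12 c3.
  rewrite -(contourD h1c c2) -(contourD c12 c3) -(contourD c123 c4).
  apply: eq_contour => t tf.
  have /lt_le_trans/(_ (square_frame_ge s0 tf)) := s0; rewrite normc_gt0 => tz.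
  have /lt_le_trans/(_ (Qge _ tf)) : 0 < s / 2 by lra.
  rewrite normc_gt0 => tw.
  move: tz tw; rewrite /r /h3 /h2 /h1 /Q /P opprD addrA.
  by set v := t - z => v0 vu0; field; rewrite v0 vu0.
rewrite addrC addKr ComplexField.Normc.normcM normcX mulrC ler_wpM2r//.
  by rewrite exprn_ge0// normc_ge0.
rewrite (_ : 4 * s = (complex.Re z + s - (complex.Re z - s)) +
  (complex.Im z + s - (complex.Im z - s))); last by ring.
apply: contour_le => //.
move=> t tf; rewrite /r /h3 /h2 /h1 /P /Q.
rewrite !ComplexField.Normc.normcM !ComplexField.Normc.normcV.
have M0 : 0 <= M by apply: le_trans (MP _ tf); exact: normc_ge0.
have Pb : (normc (t - z))^-1 <= s^-1.
  by rewrite lef_pV2 ?posrE ?(square_frame_ge s0 tf)//;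
    apply: lt_le_trans (square_frame_ge s0 tf).
have Qb : (normc (t - (z + u)))^-1 <= 2 / s.
  rewrite -[2 / s]invf_div lef_pV2 ?posrE ?Qge ?divr_gt0//.
  by apply: lt_le_trans (Qge _ tf); rewrite divr_gt0.
have P0 : 0 <= (normc (t - z))^-1 by rewrite invr_ge0 normc_ge0.
have -> : M / s ^+ 3 = M * s^-1 * s^-1 * s^-1.
  by rewrite -exprVn !exprS expr0 mulr1 !mulrA.
have hM := MP _ tf.
have h0 := normc_ge0 (h t).
have Q0 : 0 <= (normc (t - (z + u)))^-1 by rewrite invr_ge0 normc_ge0.
by repeat (apply: ler_pM => //; try do ![apply: mulr_ge0 => //]).
Qed.

End CauchyExpansion.

(** * Second-order approximation and differentiability of the difference quotient *)

Section RemovableSingularity.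
Context {R : realType}.
Local Notation C := (R[i]^o).
Local Notation mu := (@lebesgue_measure R).
Implicit Types (a b c d x y s e M : R) (z w k u : R[i]) (f g h : R[i] -> R[i]).

Lemma Rintegral_segment_ge a b e (v : R -> R) : a <= b ->
  mu.-integrable `[a, b]%classic (EFin \o v) ->
  (forall t, a <= t <= b -> e <= v t) ->
  e * (b - a) <= (\int[mu]_(t in `[a, b]%classic) v t)%R.
Proof.
move=> ab iv ve; rewrite -(fine_lebesgue_segment ab) -Rintegral_cst//.
apply: le_Rintegral => //.
apply: measurable_bounded_integrable => //; last exact: bounded_cst.
exact: lebesgue_segment_lty.
Qed.

Lemma Rintegral_segment_le a b e (v : R -> R) : a <= b ->
  mu.-integrable `[a, b]%classic (EFin \o v) ->
  (forall t, a <= t <= b -> v t <= e) ->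
  (\int[mu]_(t in `[a, b]%classic) v t)%R <= e * (b - a).
Proof.
move=> ab iv ve; rewrite -(fine_lebesgue_segment ab) -Rintegral_cst//.
apply: le_Rintegral => //.
apply: measurable_bounded_integrable => //; last exact: bounded_cst.
exact: lebesgue_segment_lty.
Qed.

(* Along each side the relevant part of [dt / (t - z)] is at least [1 / (2 s)],
   so the imaginary part of the integral is at least 4. *)
Lemma square_contour_inv_neq0 (z : R[i]) s : 0 < s ->
  square_contour (fun t => (t - z)^-1) z s != 0.
Proof.
case: z => x y s0; rewrite /square_contour /=.
set f := fun t => _.
have fc : continuous_on (frame (x - s) (x + s) (y - s) (y + s)) f.
  move=> t tf; apply: derivable_continuous; apply: derivable_invB.
  by apply: frame_neq tf; apply/andP; split; lra.
have [[_ f1] [_ f2] [f3 _] [f4 _]] := frame_cintegrable fc.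
have ImE (p q : R) : complex.Im ((p +i* q)^-1) = - q / (p ^+ 2 + q ^+ 2).
  by rewrite /= mulNr.
have ReE (p q : R) : complex.Re ((p +i* q)^-1) = p / (p ^+ 2 + q ^+ 2) by [].
have subE (p q p' q' : R) : (p +i* q) - (p' +i* q') = (p - p') +i* (q - q') by [].
(* The denominator is at most [2 * s ^+ 2]. *)
have frac (p : R) : - s <= p <= s -> (2 * s)^-1 <= s / (p ^+ 2 + s ^+ 2).
  move=> /andP[ps sp].
  have D0 : 0 < p ^+ 2 + s ^+ 2 by rewrite ltr_wpDl ?sqr_ge0 ?exprn_gt0.
  have D2 : p ^+ 2 <= s ^+ 2.
    by rewrite -subr_ge0 subr_sqr mulr_ge0//; lra.
  rewrite ler_pdivlMr// ler_pdivrMl ?mulr_gt0//.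
  by rewrite -mulrA -expr2; lra.
pose e := (2 * s)^-1.
have eE : e * (s + s) = 1 by rewrite /e; field; lra.
have xs : x - s <= x + s by lra.
have ys : y - s <= y + s by lra.
have b1 := @Rintegral_segment_ge _ _ e _ xs f1.
have b2 := @Rintegral_segment_le _ _ (- e) _ xs f2.
have b3 := @Rintegral_segment_ge _ _ e _ ys f3.
have b4 := @Rintegral_segment_le _ _ (- e) _ ys f4.
(* The factor ['i] turns real parts along the vertical sides into imaginary parts. *)
have Im_contour (A B E F : R[i]) : complex.Im (A - B + 'i * (E - F)) =
    complex.Im A - complex.Im B + complex.Re E - complex.Re F.
  by case: A B E F => [? ?] [? ?] [? ?] [? ?] /=; ring.
suff : 0 < complex.Im (contour f (x - s) (x + s) (y - s) (y + s)).
  by apply: contraPneq => ->; rewrite ltxx.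
rewrite /contour Im_contour /=.
have e1 : forall t, x - s <= t <= x + s -> e <= complex.Im (f (t +i* (y - s))).
  move=> t /andP[t1 t2]; rewrite /f subE ImE.
  rewrite (_ : y - s - y = - s) ?sqrrN ?opprK; last by ring.
  by apply: frac; lra.
have e2 : forall t, x - s <= t <= x + s -> complex.Im (f (t +i* (y + s))) <= - e.
  move=> t /andP[t1 t2]; rewrite /f subE ImE.
  rewrite (_ : y + s - y = s); last by ring.
  by rewrite mulNr lerN2; apply: frac; lra.
have e3 : forall t, y - s <= t <= y + s -> e <= complex.Re (f ((x + s) +i* t)).
  move=> t /andP[t1 t2]; rewrite /f subE ReE.
  rewrite (_ : x + s - x = s); last by ring.
  by rewrite [s ^+ 2 + _]addrC; apply: frac; lra.
have e4 : forall t, y - s <= t <= y + s -> complex.Re (f ((x - s) +i* t)) <= - e.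
  move=> t /andP[t1 t2]; rewrite /f subE ReE.
  rewrite (_ : x - s - x = - s); last by ring.
  by rewrite mulNr lerN2 sqrrN [s ^+ 2 + _]addrC; apply: frac; lra.
move: (b1 e1) (b2 e2) (b3 e3) (b4 e4).
rewrite (_ : x + s - (x - s) = s + s); last by ring.
rewrite (_ : y + s - (y - s) = s + s); last by ring.
rewrite mulNr eE /=; lra.
Qed.

(** A second-order Taylor approximation at 0 with cubic error, stated without reference to
    derivatives of [F]. *)
Definition quadratic_at (F : R[i] -> R[i]) (n0 n1 n2 : R[i]) :=
  exists B r, 0 < r /\ forall u, normc u <= r ->
    normc (F u - (n0 + n1 * u + n2 * u ^+ 2)) <= B * normc u ^+ 3.

(** The coefficients are those of the formal power series quotient of [N] by [W] up to degree 2.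
    Multiplying the error of [F] by [W], which stays away from 0 near 0, leaves only terms of order
    3 and higher. *)
Lemma quadratic_div (F N W : R[i] -> R[i]) (n0 n1 n2 w0 w1 w2 : R[i]) :
  quadratic_at N n0 n1 n2 -> quadratic_at W w0 w1 w2 -> w0 != 0 ->
  (exists2 r, 0 < r & forall u, normc u <= r -> N u = F u * W u) ->
  exists a0 a1 a2 : R[i], quadratic_at F a0 a1 a2.
Proof.
move=> [B1 [r1 [r10 NP]]] [B2 [r2 [r20 WP]]] w00 [r3 r30 FP].
pose a0 := n0 / w0; pose a1 := (n1 - a0 * w1) / w0.
pose a2 := (n2 - a0 * w2 - a1 * w1) / w0.
exists a0, a1, a2.
have nw0 : 0 < normc w0 by rewrite normc_gt0.
pose L := normc w1 + normc w2 + `|B2|.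
have L0 : 0 <= L by rewrite !addr_ge0 ?normc_ge0.
pose A := normc a0 + normc a1 + normc a2.
have A0 : 0 <= A by rewrite !addr_ge0 ?normc_ge0.
(* [k3] and [w2 * a2] are the coefficients of degrees 3 and 4 in the product of the approximations
   of [W] and [F]. *)
pose k3 := w1 * a2 + w2 * a1.
pose B := `|B1| + `|B2| * A + normc k3 + normc (w2 * a2).
pose r4 := normc w0 / (2 * (L + 1)).
have L1 : 0 < L + 1 by lra.
have r40 : 0 < r4 by rewrite divr_gt0// mulr_gt0.
(* The factor [2 / normc w0] comes from the lower bound [normc w0 / 2] on [W], which the radius [r4]
   ensures. Radius at most 1 lets higher powers of [normc u] be absorbed into lower ones. *)
exists (2 * B / normc w0), (Num.min 1 (Num.min (Num.min r1 r2) (Num.min r3 r4))).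
split; first by rewrite !lt_min ltr01 r10 r20 r30 r40.
move=> u; rewrite !le_min => /and3P[u1 /andP[ur1 ur2] /andP[ur3 ur4]].
have U0 := normc_ge0 u; set U := normc u in u1 ur1 ur2 ur3 ur4 U0 *.
have U2 : U ^+ 2 <= U by rewrite expr2 ler_piMl.
have U3 : U ^+ 3 <= U by rewrite exprS ler_piMr// exprn_ile1.
have U43 : U ^+ 4 <= U ^+ 3 by rewrite exprS ler_piMl// exprn_ge0.
have U30 : 0 <= U ^+ 3 by rewrite exprn_ge0.
have W_ge : normc w0 / 2 <= normc (W u).
  have W1 : normc (W u - w0) <= L * U.
    rewrite (_ : W u - w0 = (W u - (w0 + w1 * u + w2 * u ^+ 2)) +
      (w1 * u + w2 * u ^+ 2)); last by ring.
    apply: le_trans (le_normcD _ _) _.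
    have h1 : normc (w1 * u + w2 * u ^+ 2) <= normc w1 * U + normc w2 * U.
      apply: le_trans (le_normcD _ _) _.
      rewrite (ComplexField.Normc.normcM w1) (ComplexField.Normc.normcM w2).
      by rewrite normcX lerD2l ler_wpM2l ?normc_ge0.
    have h2 : normc (W u - (w0 + w1 * u + w2 * u ^+ 2)) <= `|B2| * U.
      apply: le_trans (WP _ ur2) _.
      apply: (@le_trans _ _ (`|B2| * U ^+ 3)); last by rewrite ler_wpM2l.
      by rewrite ler_wpM2r// ler_norm.
    by rewrite /L !mulrDl; lra.
  have : normc w0 <= normc (W u) + normc (W u - w0).
    rewrite [normc (W u - w0)]normcB -{1}(subrKC (W u) w0).
    exact: le_normcD.
  have : (L + 1) * U <= normc w0 / 2.
    rewrite mulrC -ler_pdivlMr//; apply: le_trans ur4 _.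
    by rewrite /r4 invfM mulrA.
  by rewrite mulrDl mul1r; lra.
set p := a0 + a1 * u + a2 * u ^+ 2.
have p_le : normc p <= A.
  rewrite /p /A; apply: le_trans (le_normcD _ _) _; apply: lerD.
    apply: le_trans (le_normcD _ _) _; rewrite lerD2l.
    by rewrite ComplexField.Normc.normcM ler_piMr ?normc_ge0.
  rewrite ComplexField.Normc.normcM normcX ler_piMr ?normc_ge0//.
  exact: le_trans U2 u1.
have key : (F u - p) * W u = (N u - (n0 + n1 * u + n2 * u ^+ 2)) -
    (W u - (w0 + w1 * u + w2 * u ^+ 2)) * p - k3 * u ^+ 3 - w2 * a2 * u ^+ 4.
  by rewrite (FP _ ur3) /p /k3 /a2 /a1 /a0; field.
have key_le : normc (F u - p) * normc (W u) <= B * U ^+ 3.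
  rewrite -ComplexField.Normc.normcM key.
  have h1 : normc (N u - (n0 + n1 * u + n2 * u ^+ 2)) <= `|B1| * U ^+ 3.
    by apply: le_trans (NP _ ur1) _; rewrite ler_wpM2r// ler_norm.
  have h2 : normc ((W u - (w0 + w1 * u + w2 * u ^+ 2)) * p) <= `|B2| * U ^+ 3 * A.
    rewrite ComplexField.Normc.normcM; apply: ler_pM; rewrite ?normc_ge0//.
    by apply: le_trans (WP _ ur2) _; rewrite ler_wpM2r// ler_norm.
  have h3 : normc (k3 * u ^+ 3) = normc k3 * U ^+ 3.
    by rewrite ComplexField.Normc.normcM normcX.
  have h4 : normc (w2 * a2 * u ^+ 4) <= normc (w2 * a2) * U ^+ 3.
    by rewrite ComplexField.Normc.normcM normcX ler_wpM2l ?normc_ge0.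
  do 3! (apply: le_trans (le_normcD _ _) _; rewrite -lerBrDr normcN).
  by rewrite h3 /B; lra.
have : normc (F u - p) * (normc w0 / 2) <= B * U ^+ 3.
  by apply: le_trans key_le; rewrite ler_wpM2l ?normc_ge0.
rewrite -ler_pdivlMr ?divr_gt0// => /le_trans; apply.
by rewrite le_eqVlt; apply/orP; left; apply/eqP; field; lra.
Qed.

(** The value at [z] is a parameter, to be chosen so that the singularity is removed. *)
Definition diff_quotient (f : R[i] -> R[i]) (z l w : R[i]) :=
  if w == z then l else (f w - f z) / (w - z).

(** From [f (z + u) = a0 + a1 u + a2 u^2 + O(|u|^3)] the quotient is [a1 + a2 u + O(|u|^2)]. Hence
    [a1] is the right value at [z], and the quotient has derivative [a2] there. *)
Lemma derivable_diff_quotient (f : R[i] -> R[i]) (z : R[i]) :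
  (\forall w \near (z : C), derivable (f : C -> C) w 1) ->
  exists l, derivable (diff_quotient f z l : C -> C) z 1.
Proof.
move=> /nbhs_normc[r r0 df].
(* Points of the square lie within [2 * s < r] of [z]. *)
pose s := r / 3.
have s0 : 0 < s by rewrite divr_gt0.
set x := complex.Re z; set y := complex.Im z.
have dbox w : box (x - s) (x + s) (y - s) (y + s) w -> derivable (f : C -> C) w 1.
  move=> [/andP[? ?] /andP[? ?]]; apply: df.
  apply: le_lt_trans (ler_normc_ReIm _) _; rewrite !raddfB /=.
  apply: (@le_lt_trans _ _ (s + s)); last by rewrite /s; lra.
  by apply: lerD; rewrite ler_norml; apply/andP; split; lra.
have xs : x - s <= x + s by lra.
have ys : y - s <= y + s by lra.
have fc : continuous_on (square_frame z s) f.
  by move=> w /(frame_box xs ys) /dbox; exact: derivable_continuous.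
have [n0 [n1 [n2 [B1 NP]]]] := cauchy_integral_expansion s0 fc.
(* With [h] constantly 1 this expands the factor that multiplies [f (z + u)] in Cauchy's formula. *)
have [w0 [w1 [w2 [B2 WP]]]] :=
  cauchy_integral_expansion s0 (@continuous_cst_on _ (square_frame z s) 1).
have WE u : square_contour (fun t => 1 * (t - (z + u))^-1) z s =
    square_contour (fun t => (t - (z + u))^-1) z s.
  by apply: eq_contour => t _; rewrite mul1r.
(* At [u = 0] the error bound is 0, so [w0] is the integral of [(t - z)^-1] itself. *)
have w00 : w0 != 0.
  have := WP 0; rewrite WE ComplexField.Normc.normc0 addr0.
  rewrite expr0n /= !mulr0 expr0n /= !mulr0 !addr0 => /(_ (ltW (divr_gt0 s0 (ltr0Sn _ 1)))).
  move=> h; have : normc (square_contour (fun t => (t - z)^-1) z s - w0) == 0.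
    by rewrite eq_le h normc_ge0.
  by rewrite normc_eq0 subr_eq0 => /eqP <-; exact: square_contour_inv_neq0.
have [a0 [a1 [a2 [B [q [q0 FP]]]]]] : exists a0 a1 a2 : R[i],
    quadratic_at (fun u => f (z + u)) a0 a1 a2.
  apply: (@quadratic_div _ (fun u => square_contour (fun t => f t * (t - (z + u))^-1) z s)
    (fun u => square_contour (fun t => 1 * (t - (z + u))^-1) z s) n0 n1 n2 w0 w1 w2) => //.
  - by exists B1, (s / 2); split=> //; rewrite divr_gt0.
  - by exists B2, (s / 2); split=> //; rewrite divr_gt0.
  - exists (s / 2); first by rewrite divr_gt0.
    move=> u us; rewrite WE.
    have zuE : z + u = (x + complex.Re u) +i* (y + complex.Im u).
      by apply/eqP; rewrite eq_complex /= !raddfD !eqxx.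
    have := le_trans (ler_Re_normc u) us; have := le_trans (ler_Im_normc u) us.
    rewrite !ler_norml => /andP[? ?] /andP[? ?].
    rewrite zuE /square_contour -/x -/y.
    by apply: cauchy_formula => //; apply/andP; split; lra.
have fz : f z = a0.
  have := FP 0; rewrite ComplexField.Normc.normc0 addr0 => /(_ (ltW q0)).
  rewrite !expr0n /= !mulr0 !addr0 => h.
  by apply/eqP; rewrite -subr_eq0 -normc_eq0 eq_le h normc_ge0.
exists a1; apply/derivable_normc; exists a2 => e e0.
(* After division by [u] the error is at most [B * normc u ^+ 2]; the second radius brings this
   below [e * normc u]. *)
exists (Num.min q (e / (`|B| + 1))).
  by rewrite lt_min q0 divr_gt0// ltr_wpDl.
move=> w; rewrite lt_min => /andP[wq we].
rewrite /diff_quotient eqxx.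
have [->|wz] := eqVneq w z.
  by rewrite !subrr mulr0 subrr ComplexField.Normc.normc0 mulr0.
have := FP (w - z) (ltW wq); rewrite subrKC; set u := w - z => h.
have u0 : u != 0 by rewrite subr_eq0.
have U0 : 0 < normc u by rewrite normc_gt0.
rewrite (_ : _ - _ - _ = (f w - (a0 + a1 * u + a2 * u ^+ 2)) / u); last first.
  by rewrite fz; field.
rewrite ComplexField.Normc.normcM ComplexField.Normc.normcV ler_pdivrMr//.
apply: (le_trans h).
rewrite -mulrA -expr2 exprS mulrA ler_wpM2r ?sqr_ge0//.
apply: (@le_trans _ _ ((`|B| + 1) * normc u)).
  by rewrite ler_pM2r// ler_wpDr// ler_norm.
by rewrite mulrC -ler_pdivlMr ?ltr_wpDl// ltW.
Qed.

End RemovableSingularity.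

(** * Weighted Bergman spaces *)

Section BergmanSpace.
Context {R : realType}.
Local Notation C := (R[i]^o).
Implicit Types (z w k : R[i]) (f g h : R[i] -> R[i]) (Omega : set R[i]).
Implicit Types (phi : R[i] -> R).

(** An open set is the countable union of the open rectangles with rational corners that it
    contains, hence Borel, and Borel sets are Caratheodory measurable. *)
Lemma open_plane_measurable Omega : open (Omega : set C) ->
  measurable (@plane R @^-1` Omega : set (planeT R)).
Proof.
move=> oO; apply: (@sub_caratheodory _ _ R (@area_borel R)).
apply: sub_sigma_algebra.
pose rect (q : rat * rat * rat * rat) : set (measurableTypeR R * measurableTypeR R) :=
  `]ratr q.1.1.1, ratr q.1.1.2[%classic `*` `]ratr q.1.2, ratr q.2[%classic.
(* Rectangles not contained in the set are replaced by the empty set, so that the union runs over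
   all rational quadruples. *)
pose F q : set (measurableTypeR R * measurableTypeR R) :=
  if `[< rect q `<=` @plane R @^-1` Omega >] then rect q else set0.
rewrite (_ : _ @^-1` _ = \bigcup_q F q).
  apply: countable_bigcupT_measurable => // q; rewrite /F.
  by case: ifP => // _; apply: measurableX; exact: measurable_itv.
apply/seteqP; split => [[x y] /= Oxy|p [q _]]; last first.
  by rewrite /F; case: asboolP => // sub /sub.
have /nbhs_normc[d d0 dP] := open_nbhs_nbhs (conj oO Oxy).
have d2 : 0 < d / 2 by rewrite divr_gt0.
have [a /itvP aP] := @rat_in_itvoo R _ _ (ltac:(lra) : x - d / 2 < x).
have [b /itvP bP] := @rat_in_itvoo R _ _ (ltac:(lra) : x < x + d / 2).
have [a' /itvP aP'] := @rat_in_itvoo R _ _ (ltac:(lra) : y - d / 2 < y).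
have [b' /itvP bP'] := @rat_in_itvoo R _ _ (ltac:(lra) : y < y + d / 2).
exists (a, b, a', b') => //; rewrite /F ifT; last first.
  apply/asboolP => -[x' y'] [/=]; rewrite !in_itv /= => /andP[? ?] /andP[? ?].
  apply: dP; apply: le_lt_trans (ler_normc_ReIm _) _ => /=.
  have ha : x - d / 2 < ratr a by rewrite aP.
  have hb : ratr b < x + d / 2 by rewrite bP.
  have hc : y - d / 2 < ratr a' by rewrite aP'.
  have hd : ratr b' < y + d / 2 by rewrite bP'.
  rewrite [ltRHS](splitr d); apply: ltrD; rewrite ltr_norml; apply/andP; split; lra.
by split => /=; rewrite in_itv /= ?aP ?bP ?aP' ?bP'.
Qed.

(** Open rays generate the Borel sets of the line, and the part of [Omega] where [F] exceeds [a] is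
    open even though [F] is continuous only at points of [Omega]. *)
Lemma continuous_plane_measurable Omega (F : R[i] -> R) :
  open (Omega : set C) ->
  (forall z, Omega z -> {for z, continuous (F : C -> R)}) ->
  measurable_fun (@plane R @^-1` Omega : set (planeT R)) (F \o @plane R).
Proof.
move=> oO Fc mD; apply: (measurability _ (RGenOInfty.measurableE R)) => //.
move=> _ [_ [a ->] <-].
rewrite (_ : _ `&` _ = @plane R @^-1` [set z | Omega z /\ a < F z]); last first.
  by apply/seteqP; split => p /=; rewrite in_itv /= andbT.
apply: open_plane_measurable; rewrite openE => z [Oz az]; rewrite /interior.
have O1 : nbhs (z : C) Omega by exact: open_nbhs_nbhs.
have F1 : nbhs (z : C) [set w | a < F w].
  by apply: (Fc z Oz [set x | a < x]); apply: open_nbhs_nbhs; split.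
by apply: filterS2 O1 F1 => w.
Qed.

Lemma continuous_normc : continuous (fun z : C => normc z : R).
Proof.
move=> z; apply/(@cvgrPdist_lt _ _ _ (nbhs (z : C))) => e e0.
apply/nbhs_normc; exists e => // w we; rewrite ltr_norml.
have := ler_normcB w z; have := ler_normcB z w.
by rewrite [normc (z - w)]normcB => ? ?; apply/andP; split; lra.
Qed.

Lemma sqr_normc_plane_measurable Omega f : open (Omega : set C) ->
  continuous_on Omega f ->
  measurable_fun (@plane R @^-1` Omega : set (planeT R))
    (fun p => normc (f (plane p)) ^+ 2).
Proof.
move=> oO fc; apply: measurable_funX.
apply: (@continuous_plane_measurable Omega (fun z => normc (f z))) => // z Oz.
by apply: (@continuous_comp _ _ _ (f : C -> C) (fun z : C => normc z : R));
  [exact: fc|exact: continuous_normc].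
Qed.

Lemma holomorphic_onB Omega k f h : holomorphic_on Omega f ->
  holomorphic_on Omega h -> holomorphic_on Omega (fun z => f z - k * h z).
Proof.
move=> fO hO z Oz; apply: (@derivableB _ C C (f : C -> C)); first exact: fO.
by apply: (@derivableZ _ C C (h : C -> C)); exact: hO.
Qed.

Lemma holomorphic_on_continuous Omega f : holomorphic_on Omega f ->
  continuous_on Omega f.
Proof. by move=> fO z /fO; exact: derivable_continuous. Qed.

(** The cofactor is the difference quotient at [c]. Differentiability at [c] itself is the content
    of [derivable_diff_quotient]; elsewhere it is the quotient rule. *)
Lemma holomorphic_factor Omega (c : R[i]) f : open (Omega : set C) -> Omega c ->
  holomorphic_on Omega f -> f c = 0 ->
  exists2 g, holomorphic_on Omega g & forall z, f z = (z - c) * g z.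
Proof.
move=> oO Oc fO fc.
have [l lP] : exists l, derivable (diff_quotient f c l : C -> C) c 1.
  apply: derivable_diff_quotient.
  by apply: filterS (open_nbhs_nbhs (conj oO Oc)) => z; exact: fO.
exists (diff_quotient f c l) => [z Oz|z]; rewrite /diff_quotient; last first.
  have [->|zc] := eqVneq z c; first by rewrite subrr mul0r.
  by rewrite fc subr0 mulrC divfK// subr_eq0.
have [->//|zc] := eqVneq z c.
(* On a disc around [z] that misses [c] the case distinction in [diff_quotient] disappears. *)
apply: (@near_eq_derivable R[i] C C (fun w => (f w - f c) * (w - c)^-1)).
  have : \forall w \near (z : C), normc (w - z) < normc (z - c).
    by apply/nbhs_normc; exists (normc (z - c)) => //; rewrite normc_gt0 subr_eq0.
  apply: filterS => w; rewrite /diff_quotient.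
  by case: eqVneq => // ->; rewrite normcB ltxx.
apply: (@derivableM _ C (fun t : C => f t - f c)); last exact: derivable_invB.
by apply: (@derivableB _ C C (f : C -> C)); [exact: fO|exact: derivable_cst].
Qed.

Variables (Omega : set R[i]) (phi : R[i] -> R).
Hypotheses (oO : open (Omega : set C)) (wphi : weight Omega phi).
Local Notation D := (@plane R @^-1` Omega : set (planeT R)).

(** [A2] only states that the integral is finite; measurability comes from the continuity of [f] and
    from the weight. *)
Lemma A2_integrable f : A2 Omega phi f ->
  (@area R).-integrable D (EFin \o (fun p => normc (f (plane p)) ^+ 2 * phi (plane p))).
Proof.
move=> [fO fi]; apply/integrableP; split.
  have fm := @sqr_normc_plane_measurable Omega f oO (holomorphic_on_continuous fO).
  by apply/measurable_EFinP; exact: measurable_funM fm wphi.2.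
under eq_integral => p /set_mem Dp.
  rewrite /= ger0_norm; last by rewrite mulr_ge0 ?sqr_ge0//; exact: wphi.1.
  over.
exact: fi.
Qed.

Lemma A2_cintegrable f h : A2 Omega phi f -> A2 Omega phi h ->
  cintegrable (@area R) D
    (fun p => f (plane p) * (h (plane p))^* * (phi (plane p))%:C).
Proof.
move=> fA hA.
have mD := open_plane_measurable oO.
have fh := integrableD mD (A2_integrable fA) (A2_integrable hA).
have fc := holomorphic_on_continuous fA.1.
have hc := holomorphic_on_continuous hA.1.
have fhc : continuous_on Omega (fun z => f z * (h z)^*).
  move=> z Oz; apply: (@continuousM R[i] C (f : C -> C)); first exact: fc.
  apply: (@continuous_comp _ _ _ (h : C -> C) (@conjc R : C -> C)).
    exact: hc.
  exact: continuous_conjc.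
have bound p : D p -> normc (f (plane p) * (h (plane p))^*) * phi (plane p) <=
    normc (f (plane p)) ^+ 2 * phi (plane p) + normc (h (plane p)) ^+ 2 * phi (plane p).
  move=> Dp; rewrite -mulrDl ler_wpM2r//; first exact: wphi.1.
  rewrite ComplexField.Normc.normcM normcJ.
  have := normc_ge0 (f (plane p)); have := normc_ge0 (h (plane p)).
  by set a := normc _; set b := normc _; nra.
(* [P] stands for the real and the imaginary part. *)
have main (P : R[i] -> R) : continuous (P : C -> R) ->
    (forall z, `|P z| <= normc z) ->
    (@area R).-integrable D
      (EFin \o (fun p => P (f (plane p) * (h (plane p))^*) * phi (plane p))).
  move=> Pc Pn; apply: le_integrable fh => //.
    apply/measurable_EFinP; apply: measurable_funM; last exact: wphi.2.
    apply: (@continuous_plane_measurable Omega (fun z => P (f z * (h z)^*))) => //.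
    move=> z Oz.
    apply: (@continuous_comp _ _ _ ((fun z => f z * (h z)^*) : C -> C) (P : C -> R)).
      exact: fhc.
    exact: Pc.
  move=> p Dp /=; rewrite lee_fin normrM.
  have phi0 : 0 <= phi (plane p) by exact: wphi.1.
  apply: le_trans (ler_norm _); apply: le_trans (bound _ Dp).
  by rewrite (ger0_norm phi0) ler_wpM2r.
split.
  have := main _ (@continuous_Re R) (@ler_Re_normc R).
  apply: eq_integrable => // p _ /=; congr EFin.
  by case: (f (plane p) * (h (plane p))^*) => x y /=; rewrite mulr0 subr0.
have := main _ (@continuous_Im R) (@ler_Im_normc R).
apply: eq_integrable => // p _ /=; congr EFin.
by case: (f (plane p) * (h (plane p))^*) => x y /=; rewrite mulr0 add0r.
Qed.

(** The majorant comes from [(a + b)^2 <= 2 a^2 + 2 b^2] with [a = |f|] and [b = |k| |h|]. *)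
Lemma A2B k f h : A2 Omega phi f -> A2 Omega phi h ->
  A2 Omega phi (fun z => f z - k * h z).
Proof.
move=> fA hA; have mD := open_plane_measurable oO.
split; first exact: holomorphic_onB fA.1 hA.1.
have hol := holomorphic_onB (k := k) fA.1 hA.1.
have fh := integrableD mD (integrableZl mD 2 (A2_integrable fA))
  (integrableZl mD (2 * normc k ^+ 2) (A2_integrable hA)).
have mf : measurable_fun D
    (fun p => normc (f (plane p) - k * h (plane p)) ^+ 2 * phi (plane p)).
  have fm := @sqr_normc_plane_measurable Omega (fun z => f z - k * h z) oO
    (holomorphic_on_continuous hol).
  exact: measurable_funM fm wphi.2.
apply: (integrable_lty mD).
refine (le_integrable mD _ _ fh); first exact/measurable_EFinP.
move=> p Dp /=; rewrite lee_fin.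
have phi0 : 0 <= phi (plane p) by exact: wphi.1.
rewrite ger0_norm; last by rewrite mulr_ge0// sqr_ge0.
apply: le_trans (ler_norm _).
rewrite !mulrA -mulrDl ler_wpM2r//.
have h1 : normc (f (plane p) - k * h (plane p)) <=
    normc (f (plane p)) + normc k * normc (h (plane p)).
  by rewrite -ComplexField.Normc.normcM -(normcN (k * _)); exact: le_normcD.
apply: (@le_trans _ _ ((normc (f (plane p)) + normc k * normc (h (plane p))) ^+ 2)).
  by rewrite lerXn2r// ?nnegrE ?addr_ge0 ?mulr_ge0 ?normc_ge0.
set a := normc _; set b := normc k; set d := normc _.
by rewrite -subr_ge0 (_ : _ - _ = (a - b * d) ^+ 2) ?sqr_ge0//; ring.
Qed.

Lemma wdotB k f h1 h2 : A2 Omega phi f -> A2 Omega phi h1 -> A2 Omega phi h2 ->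
  wdot Omega phi f (fun z => h1 z - k * h2 z) =
  wdot Omega phi f h1 - k^* * wdot Omega phi f h2.
Proof.
move=> fA h1A h2A; have mD := open_plane_measurable oO.
have i1 := A2_cintegrable fA h1A.
have i2 := A2_cintegrable fA h2A.
have i3 := cintegrableZ mD k^* i2.
rewrite -[wdot Omega phi f h1]/(cint _ _ _) -[wdot Omega phi f h2]/(cint _ _ _).
rewrite -(cintZ mD _ i2) -(cintB mD i1 i3).
by apply: eq_cint => p _; rewrite rmorphB rmorphM /=; ring.
Qed.

Lemma wdotC f h : A2 Omega phi f -> A2 Omega phi h ->
  wdot Omega phi h f = (wdot Omega phi f h)^*.
Proof.
move=> fA hA; have mD := open_plane_measurable oO.
rewrite -[wdot Omega phi f h]/(cint _ _ _) -(cint_conj mD (A2_cintegrable fA hA)).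
apply: eq_cint => p _; rewrite !(rmorphM (@conjc R)) /= conjcK oppr0.
by congr (_ * _); rewrite mulrC.
Qed.

End BergmanSpace.

(** * The kernel of the shifted weight *)

Section ShiftedWeight.
Context {R : realType}.
Variables (Omega : set R[i]) (c : R[i]) (phi : R[i] -> R).
Local Notation C := (R[i]^o).
Local Notation shifted := (fun z => normc (z - c) ^+ 2 * phi z).

(** Multiplication by [z - c] moves the factor [|z - c|^2] from the weight into the function without
    changing the integrand. With [wdot_shifted] this makes it an isometry from the shifted space
    into the original one. *)
Lemma A2_shiftedP (f g : R[i] -> R[i]) : holomorphic_on Omega f ->
  (forall z, f z = (z - c) * g z) ->
  holomorphic_on Omega g -> A2 Omega shifted g <-> A2 Omega phi f.
Proof.
move=> fO fg gO.
have E p : normc (g (plane p)) ^+ 2 * (normc (plane p - c) ^+ 2 * phi (plane p)) =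
    normc (f (plane p)) ^+ 2 * phi (plane p).
  by rewrite fg ComplexField.Normc.normcM exprMn mulrA [X in X * phi _]mulrC.
rewrite /A2 /=; under eq_integral do rewrite E.
by split=> -[].
Qed.

Lemma wdot_shifted (f1 g1 f2 g2 : R[i] -> R[i]) :
  (forall z, f1 z = (z - c) * g1 z) -> (forall z, f2 z = (z - c) * g2 z) ->
  wdot Omega shifted g1 g2 = wdot Omega phi f1 f2.
Proof.
move=> fg1 fg2; apply: eq_cint => p _.
have E : (normc (plane p - c) ^+ 2 * phi (plane p))%:C =
    (plane p - c) * (plane p - c)^* * (phi (plane p))%:C.
  by rewrite rmorphM rmorphXn -sqr_normc norm_normc.
rewrite E fg1 fg2 (rmorphM (@conjc R)) /=; ring.
Qed.

End ShiftedWeight.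

Section KernelFormula.
Context {R : realType}.
Variables (Omega : set R[i]) (c : R[i]) (phi : R[i] -> R).
Local Notation C := (R[i]^o).
Local Notation shifted := (fun z => normc (z - c) ^+ 2 * phi z).

(** With the denominators [z - c] and [w^* - c^*] cleared, the identity holds for all [z] and [w] in
    [Omega], including [c]. *)
Lemma bergman_kernel_shifted (K Kc : R[i] -> R[i] -> R[i]) (z w : R[i]) :
  open (Omega : set C) -> Omega c -> weight Omega phi ->
  bergman_kernel Omega phi K -> bergman_kernel Omega shifted Kc ->
  K c c != 0 -> Omega z -> Omega w ->
  (z - c) * (w^* - c^*) * Kc z w = K z w - K z c * K c w / K c c.
Proof.
move=> oO Oc wphi [Khol _ KC KA Krep] [Kchol _ _ KcA Kcrep] Kcc Oz Ow.
pose g t := (t - c) * Kc t w.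
have gO : holomorphic_on Omega g.
  move=> t Ot; apply: (@derivableM _ C (fun t : C => t - c)); last exact: Kchol.
  by apply: (@derivableB _ C C id); [exact: derivable_id|exact: derivable_cst].
have gA : A2 Omega phi g.
  exact: (A2_shiftedP phi gO (fun=> erefl) (Kchol w Ow)).1 (KcA w Ow).
(* This coefficient makes [f], the function [k_z] of the overview, vanish at [c]. *)
pose k := K c z / K c c.
pose f t := K t z - k * K t c.
have fA : A2 Omega phi f.
  exact: (A2B oO wphi k (KA z Oz) (KA c Oc)).
have fc : f c = 0 by rewrite /f /k divfK ?subrr.
have [h hO fh] := holomorphic_factor oO Oc fA.1 fc.
have hA : A2 Omega shifted h by exact: (A2_shiftedP phi fA.1 fh hO).2 fA.
(* The reproducing property gives [g z - k^* * g c], and [g c = 0]. *)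
have gf : wdot Omega phi g f = (z - c) * Kc z w.
  rewrite /f (wdotB oO wphi _ gA (KA _ Oz) (KA _ Oc)).
  by rewrite -(Krep _ _ gA Oz) -(Krep _ _ gA Oc) /g subrr mul0r mulr0 subr0.
have hw : h w = ((z - c) * Kc z w)^*.
  rewrite (Kcrep _ _ hA Ow) (@wdot_shifted R Omega c phi f h g (Kc ^~ w) fh (fun=> erefl)).
  by rewrite (wdotC oO wphi gA fA) gf.
have fw : f w = (w - c) * ((z - c) * Kc z w)^* by rewrite fh hw.
(* Conjugating and applying the Hermitian symmetry of [K] turns the values of [K] in [f w] into
   those of the formula. *)
have := congr1 (@conjc R) fw.
rewrite (rmorphM (@conjc R)) (rmorphB (@conjc R)) /= conjcK.
rewrite /f /k (rmorphB (@conjc R)) !(rmorphM (@conjc R)) /= conjc_inv.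
rewrite -!KC// => E.
rewrite [LHS](_ : _ = (w^* - c^*) * ((z - c) * Kc z w)); last by ring.
by rewrite -E mulrAC.
Qed.

End KernelFormula.

(** * Limits at the removed singularities and the final formula *)

Lemma holomorphic_punctured_cvg (R : realType) (Omega : set R[i]) (c : R[i])
    (f g : R[i] -> R[i]) : open (Omega : set R[i]^o) -> Omega c ->
  holomorphic_on Omega f \/ holomorphic_on Omega (fun z => (f z)^*) ->
  (forall z, Omega z -> z != c -> g z = f z) -> punctured_cvg g c (f c).
Proof.
move=> oO Oc fO gf.
have fc : (f : R[i]^o -> R[i]^o) z @[z --> (c : R[i]^o)] --> (f c : R[i]^o).
  case: fO => [|] /(_ c Oc) /derivable_continuous; first by [].
  move=> /(continuous_comp (g := @conjc R : R[i]^o -> R[i]^o)).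
  move=> /(_ (@continuous_conjc R _)).
  (* In the conjugate holomorphic case continuity is recovered by conjugating a second time. *)
  by rewrite (_ : _ \o _ = f)//; apply/funext => t /=; rewrite conjcK.
rewrite /punctured_cvg.
have : f z @[z --> (c : R[i]^o)^'] --> (f c : R[i]^o).
  exact: (cvg_trans (cvg_app f (@nbhs_dnbhs R[i]^o c)) fc).
apply: cvg_trans; apply: near_eq_cvg.
have : \forall z \near (c : R[i]^o)^', Omega z.
  by apply: nbhs_dnbhs; exact: open_nbhs_nbhs.
apply: filterS2 (nbhs_dnbhs_neq (c : R[i]^o)) => z zc Oz.
by rewrite gf.
Qed.

Theorem theorem4 (R : realType) (Omega : set R[i]) (c : R[i])
    (phi : R[i] -> R) (K Kc : R[i] -> R[i] -> R[i])
    (domain_Omega : domain Omega)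
    (Omega_c : Omega c)
    (weight_phi : weight Omega phi)
    (bounded_phi : bounded_around Omega phi c)
    (kernel_K : bergman_kernel Omega phi K)
    (kernel_Kc : bergman_kernel Omega
       (fun z => ComplexField.Normc.normc (z - c) ^+ 2 * phi z) Kc)
    (Kcc_neq0 : K c c != 0) :
  removes_singularities Omega c
    (fun z w => K z w / ((z - c) * (conjc w - conjc c))
       - K z c * K c w / ((z - c) * (conjc w - conjc c) * K c c))
    Kc.
Proof.
have [_ oO _] := domain_Omega.
(* Away from [c] both factors of the denominators are nonzero, so the cleared identity can be
   divided by them. *)
have key z w : Omega z -> Omega w -> z != c -> w != c ->
    K z w / ((z - c) * (w^* - c^*)) -
    K z c * K c w / ((z - c) * (w^* - c^*) * K c c) = Kc z w.
  move=> Oz Ow zc wc.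
  have := bergman_kernel_shifted oO Omega_c weight_phi kernel_K kernel_Kc
    Kcc_neq0 Oz Ow.
  have z0 : z - c != 0 by rewrite subr_eq0.
  have w0 : w^* - c^* != 0.
    by rewrite -(rmorphB (@conjc R)) conjc_eq0 subr_eq0.
  move=> h; apply: (mulfI (mulf_neq0 z0 w0)); rewrite h.
  move: z0 w0; set a := z - c; set b := w^* - c^* => a0 b0.
  by field; rewrite a0 b0 Kcc_neq0.
have [Kchol Kcconj _ _ _] := kernel_Kc.
split.
- by move=> z w Oz Ow zc wc; rewrite key.
- move=> w Ow wc; apply: (holomorphic_punctured_cvg (f := Kc ^~ w)) oO Omega_c _ _.
    by left; exact: Kchol.
  by move=> z Oz zc; rewrite key.
- move=> z Oz zc; apply: (holomorphic_punctured_cvg (f := Kc z)) oO Omega_c _ _.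
    by right; exact: Kcconj.
  by move=> w Ow wc; rewrite key.
(* The iterated limits at [(c, c)] involve [Kc] alone and express its continuity in each
   variable. *)
- exact: (@holomorphic_punctured_cvg _ _ _ (Kc ^~ c) _ oO Omega_c
    (or_introl (Kchol c Omega_c)) (fun _ _ _ => erefl)).
- exact: (@holomorphic_punctured_cvg _ _ _ (Kc c) _ oO Omega_c
    (or_intror (Kcconj c Omega_c)) (fun _ _ _ => erefl)).
Qed.
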